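(* Let $N\ge 2$ and let $I$ be a subset of the set of vertices $\{(i,j):1\le i<j\le N\}$ of the quiver $Q_N$. For $s\in\{0,1,2\}$, write $\rho^s(T_N)$ as the product of quantum exponentials $\prod^{\rightarrow}_{\lambda\in\Lambda_N}\langle\rho^s(m_\lambda)\rangle_q$ (lexicographic order of $\lambda$), and let $\rho^s(T_N)^{I}$ denote the result of replacing by $1$, in this product, every factor $\langle\rho^s(m_\lambda)\rangle_q$ whose argument, the monomial $\rho^s(m_\lambda)$, contains at least one generator $Z_{ij}$ with $(i,j)\in I$. Then $$T_N^{I}=\rho(T_N)^{I}=\rho(\rho(T_N))^{I}.$$
   Context: Fix real $q\in(0,1)$. The quantum exponential is the formal series $\langle x\rangle_q=\sum_{n\ge 0}\frac{(-x)^n}{(1-q)(1-q^2)\cdots(1-q^n)}$. Quiver $Q_N$: its vertices are pairs of integers $(i,j)$ with $1\le i<j\le N$; its directed edges go from $(i,j)$ to $(i,j+1)$, from $(i,j)$ to $(i+1,j)$, and from $(i+1,j+1)$ to $(i,j)$, whenever both endpoints are vertices. Its skew-symmetric incidence matrix $B$ is: $B_{(i,j),(i',j')}=-B_{(i',j'),(i,j)}=1$ if there is a directed edge from $(i,j)$ to $(i',j')$, and $B_{(i,j),(i',j')}=0$ if the two vertices are not connected. $\mathcal T_N$ is the unital associative $\mathbb R$-algebra with generators $Z_{ij}$, $1\le i<j\le N$, and defining relations $Z_{ij}Z_{i'j'}=q^{B_{(i,j),(i',j')}}Z_{i'j'}Z_{ij}$. Quantum exponentials of monomials in the generators are formal series;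 they are regarded as elements of the completion of $\mathcal T_N$ consisting of all formal (possibly infinite) $\mathbb R$-linear combinations of the ordered monomials $\prod_{i<j}Z_{ij}^{\alpha_{ij}}$, $\alpha_{ij}\in\mathbb Z_{\ge0}$. $\rho$ is the algebra automorphism (of order three) with $\rho(Z_{ij})=Z_{j-i,\,N+1-i}$, extended to the completion; $\rho^0=\mathrm{id}$. Let $\Lambda_N=\{(a,b,c)\in\mathbb Z^3: 1\le a<b<c\le N+1\}$. For $\lambda=(a,b,c)\in\Lambda_N$ put $m_\lambda=Z_{a,b}Z_{a+1,b+1}\cdots Z_{a+c-b-1,\,c-1}$ (the product of $Z_{a+k,b+k}$ over $k=0,\dots,c-b-1$, with $k$ increasing from left to right). Then $T_N=\prod^{\rightarrow}_{\lambda\in\Lambda_N}\langle m_\lambda\rangle_q$, the product being taken with factors from left to right in increasing lexicographic order of $\lambda$. (The unreduced identity being modified is $T_N=\rho(T_N)=\rho(\rho(T_N))$.) *)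

(* Defs.v *)
From HB Require Import structures.
From mathcomp Require Import all_boot all_order all_algebra.
From mathcomp Require Import boolp classical_sets functions cardinality fsbigop.
From mathcomp Require Import reals interval_inference.
From mathcomp Require Import zify lra ring.

Set Implicit Arguments.
Unset Strict Implicit.
Unset Printing Implicit Defensive.

Import Order.TTheory GRing.Theory Num.Theory.
Local Open Scope ring_scope.

(* The vertex [(i, j)], with [1 <= i < j <= N]. *)
Record vertex (N : nat) := Vertex {
  vpair : 'I_N.+1 * 'I_N.+1;
  _ : (0 < vpair.1 < vpair.2)%N }.

HB.instance Definition _ N := [isSub for @vpair N].
HB.instance Definition _ N := [Finite of vertex N by <:].

Definition vi N (v : vertex N) : nat := (vpair v).1.
Definition vj N (v : vertex N) : nat := (vpair v).2.

Definition edge N (u v : vertex N) : bool :=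
  [|| (vi v == vi u) && (vj v == (vj u).+1),
      (vi v == (vi u).+1) && (vj v == vj u) |
      (vi u == (vi v).+1) && (vj u == (vj v).+1)].

Definition incidence N (u v : vertex N) : int :=
  if edge u v then 1 else if edge v u then -1 else 0.

Definition vlt N (u v : vertex N) : bool :=
  (vi u < vi v)%N || (vi u == vi v) && (vj u < vj v)%N.

Definition vle N (u v : vertex N) : bool := (u == v) || vlt u v.

Definition vertices N : seq (vertex N) := sort (@vle N) (enum {: vertex N}).

Definition expo N := {ffun vertex N -> nat}.
HB.instance Definition _ N := Choice.on (expo N).
HB.instance Definition _ N := GRing.Nmodule.on (expo N).

(* The ordered monomial [Z^a] is the product of the [Z_v ^+ a v] in increasing
   lexicographic order of [v]. The relations
   [Z_u * Z_v = q ^ incidence u v *: (Z_v * Z_u)], which define the algebra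
   [T_N] generated by the [Z_v], give
   [Z^a * Z^b = q ^ twist a b *: Z^(a + b)]: each [Z_v] of [Z^b] moves to the
   left of every [Z_u] of [Z^a] with [v < u]. *)
Definition twist N (a b : expo N) : int :=
  \sum_(u <- vertices N) \sum_(v <- vertices N | vlt v u)
     incidence u v * (a u)%:Z * (b v)%:Z.

(* The completion of [T_N]: [Series q N f] stands for [\sum_a f a *: Z^a], with
   no condition on [f]. It carries the multiplication of [T_N], hence the
   parameter [q]; see [vgenC] for the defining relations and [monE] for the
   ordered monomials. *)
Record series (R : realType) (q : {posnum R}) (N : nat) := Series {
  coef : expo N -> R }.
Arguments Series {R} q N coef.

HB.instance Definition _ (R : realType) (q : {posnum R}) N :=
  gen_eqMixin (series q N).
HB.instance Definition _ (R : realType) (q : {posnum R}) N :=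
  gen_choiceMixin (series q N).

Section SeriesAlgebra.
Context {R : realType} {q : {posnum R}} {N : nat}.
Notation S := (series q N).
Implicit Types (f g h : S) (a b c d : expo N).

Lemma seriesP f g : (forall a, coef f a = coef g a) -> f = g.
Proof. by case: f g => [f] [g] /= fg; congr Series; apply: funext. Qed.

Definition sadd f g := Series q N (fun a => coef f a + coef g a).
Definition sopp f := Series q N (fun a => - coef f a).
Definition szero := Series q N (fun=> 0).
Definition sscale (k : R) f := Series q N (fun a => k * coef f a).
Definition mon a := Series q N (fun b => (b == a)%:R).
Definition smul f g := Series q N (fun c =>
  \sum_(p \in [set p : expo N * expo N | p.1 + p.2 = c])
     q%:num ^ twist p.1 p.2 * coef f p.1 * coef g p.2).

Fact saddA : associative sadd.
Proof. by move=> f g h; apply: seriesP => a /=; rewrite addrA. Qed.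
Fact saddC : commutative sadd.
Proof. by move=> f g; apply: seriesP => a /=; rewrite addrC. Qed.
Fact sadd0 : left_id szero sadd.
Proof. by move=> f; apply: seriesP => a /=; rewrite add0r. Qed.
Fact saddN : left_inverse szero sopp sadd.
Proof. by move=> f; apply: seriesP => a /=; rewrite addNr. Qed.

HB.instance Definition _ := GRing.isZmodule.Build S saddA saddC sadd0 saddN.

Lemma coefD f g a : coef (f + g) a = coef f a + coef g a. Proof. by []. Qed.
Lemma coef0 a : coef (0 : S) a = 0. Proof. by []. Qed.

Definition box n : seq (expo N) :=
  [seq [ffun v => x v : nat] | x : {ffun vertex N -> 'I_n.+1}].

Lemma box_uniq n : uniq (box n).
Proof.
rewrite map_inj_uniq ?enum_uniq // => x y /ffunP xy; apply/ffunP => v.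
by apply: val_inj; have := xy v; rewrite !ffunE.
Qed.

Lemma mem_box n a : (a \in box n) = [forall v, (a v <= n)%N].
Proof.
apply/mapP/forallP => [[x _ -> v]|an]; first by rewrite ffunE -ltnS.
exists [ffun v => inord (a v)]; rewrite ?mem_enum //.
by apply/ffunP => v; rewrite !ffunE inordK ?ltnS.
Qed.

Lemma expoD a b v : (a + b) v = (a v + b v)%N.
Proof. by rewrite ffunE. Qed.

Lemma boxD n a b : a + b \in box n -> (a \in box n) && (b \in box n).
Proof.
rewrite !mem_box => /forallP abn; apply/andP; split; apply/forallP => v;
by have := abn v; rewrite expoD; lia.
Qed.

Lemma coefM n f g c : c \in box n ->
  coef (smul f g) c = \sum_(a <- box n) \sum_(b <- box n)
    if a + b == c then q%:num ^ twist a b * coef f a * coef g b else 0.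
Proof.
move=> cn; pose r := [seq (a, b) | a <- box n, b <- box n].
rewrite -(big_allpairs (F := fun p : expo N * expo N => if p.1 + p.2 == c then
  q%:num ^ twist p.1 p.2 * coef f p.1 * coef g p.2 else 0)) /=.
rewrite (eq_fsbigr (fun p => if p.1 + p.2 == c then
  q%:num ^ twist p.1 p.2 * coef f p.1 * coef g p.2 else 0)); last first.
  by move=> p; rewrite inE /= => ->; rewrite eqxx.
apply: fsbig_fwiden.
- move=> [a b] /= abc; apply/allpairsP; exists (a, b) => /=.
  by move: cn; rewrite -abc => /boxD /andP[].
- by rewrite allpairs_uniq ?box_uniq //; move=> [? ?] [? ?] _ _ [-> ->].
- by move=> p [_ /= pc]; rewrite ifN //; apply/eqP.
Qed.

Lemma twistDl a b c : twist (a + b) c = twist a c + twist b c.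
Proof.
rewrite /twist -big_split; apply: eq_bigr => u _.
rewrite -big_split; apply: eq_bigr => v _ /=.
by rewrite expoD PoszD mulrDr mulrDl.
Qed.

Lemma twistDr a b c : twist a (b + c) = twist a b + twist a c.
Proof.
rewrite /twist -big_split; apply: eq_bigr => u _.
rewrite -big_split; apply: eq_bigr => v _ /=.
by rewrite expoD PoszD mulrDr.
Qed.

Lemma twist0l a : twist 0 a = 0.
Proof. by have := twistDl 0 0 a; rewrite addr0; lia. Qed.

Lemma twist0r a : twist a 0 = 0.
Proof. by have := twistDr a 0 0; rewrite addr0; lia. Qed.

Lemma inbox c : c \in box (\max_v c v).
Proof. by rewrite mem_box; apply/forallP => v; apply: leq_bigmax. Qed.

Lemma box_pick n (F : expo N -> R) c : c \in box n ->
  (\sum_(a <- box n) if a == c then F a else 0) = F c.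
Proof.
move=> cn; rewrite (bigD1_seq c) ?box_uniq //= eqxx big1 ?addr0 //.
by move=> a /negbTE ->.
Qed.

Lemma box_pick_cst n (x : R) c : c \in box n ->
  (\sum_(a <- box n) if a == c then x else 0) = x.
Proof. exact: (box_pick (fun=> x)). Qed.

Fact mulr_perm_r (x y z f g h : R) :
  x * y * f * (z * g * h) = x * y * z * f * g * h.
Proof. ring. Qed.

Fact mulr_perm_l (x y z f g h : R) :
  y * z * (x * f * g) * h = x * y * z * f * g * h.
Proof. ring. Qed.

Fact smulA : associative smul.
Proof.
move=> f g h; apply: seriesP => c; have cn := inbox c; set n := (\max_v _) in cn.
have qD x y : q%:num ^ (x + y) = q%:num ^ x * q%:num ^ y :> R.
  by rewrite expfzDr // gt_eqF.
pose T a b d := if a + b + d == c then q%:num ^ (twist a b + twist a d + twist b d)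
   * coef f a * coef g b * coef h d else 0.
transitivity (\sum_(a <- box n) \sum_(b <- box n) \sum_(d <- box n) T a b d).
  rewrite (coefM _ _ cn); apply: eq_bigr => a _.
  transitivity (\sum_(e <- box n) \sum_(b <- box n) \sum_(d <- box n)
     if e == b + d then T a b d else 0).
    rewrite !big_seq; apply: eq_bigr => e en; case: eqP => [ec|ec].
      rewrite (coefM _ _ en) mulr_sumr; apply: eq_bigr => b _.
      rewrite mulr_sumr; apply: eq_bigr => d _; rewrite eq_sym.
      case: eqP => [ebd|_]; last by rewrite mulr0.
      rewrite /T -addrA -ebd ec eqxx ebd twistDr !qD.
      exact: mulr_perm_r.
    rewrite big1 // => b _; rewrite big1 // => d _; case: eqP => // ebd.
    by rewrite /T -addrA -ebd; case: eqP.
  rewrite exchange_big; apply: eq_bigr => b _.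
  rewrite exchange_big; apply: eq_bigr => d _.
  have [bdn|bdn] := boolP (b + d \in box n).
    by rewrite box_pick_cst.
  rewrite big1_seq => [|e /= en].
    by rewrite /T; case: eqP => // abd; move: cn; rewrite -abd -addrA => /boxD;
      rewrite (negbTE bdn) andbF.
  by case: eqP => // ebd; rewrite -ebd en in bdn.
rewrite (coefM _ _ cn).
transitivity (\sum_(e <- box n) \sum_(a <- box n) \sum_(b <- box n)
    \sum_(d <- box n) if e == a + b then T a b d else 0).
  symmetry; rewrite exchange_big; apply: eq_bigr => a _.
  rewrite exchange_big; apply: eq_bigr => b _.
  rewrite exchange_big; apply: eq_bigr => d _.
  have [bdn|bdn] := boolP (a + b \in box n).
    by rewrite box_pick_cst.
  rewrite big1_seq => [|e /= en].
    by rewrite /T; case: eqP => // abd; move: cn; rewrite -abd => /boxD;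
      rewrite (negbTE bdn).
  by case: eqP => // ebd; rewrite -ebd en in bdn.
rewrite !big_seq; apply: eq_bigr => e en; rewrite (coefM _ _ en).
under eq_bigr do rewrite exchange_big.
rewrite exchange_big; apply: eq_bigr => d _.
case: eqP => [edc|edc].
  rewrite mulr_sumr mulr_suml; apply: eq_bigr => a _.
  rewrite mulr_sumr mulr_suml; apply: eq_bigr => b _; rewrite eq_sym /=.
  case: eqP => [eab|_]; last by rewrite mulr0 mul0r.
  rewrite /T eab edc eqxx -eab twistDl !qD.
  exact/esym/mulr_perm_l.
rewrite big1 // => a _; rewrite big1 // => b _; case: eqP => // eab.
by rewrite /T -eab; case: eqP.
Qed.

Lemma mon_box n f a c : c \in box n ->
  coef (smul (mon a) f) c =
  \sum_(b <- box n) if a + b == c then q%:num ^ twist a b * coef f b else 0.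
Proof.
move=> cn; rewrite (coefM _ _ cn) exchange_big; apply: eq_bigr => b _.
have [an|an] := boolP (a \in box n); last first.
  rewrite ifN; last first.
    by apply: contra an => /eqP abc; move: cn; rewrite -abc => /boxD /andP[].
  rewrite big1_seq // => e en; case: ifP => // _ /=.
  by case: eqP en => [->|_ _]; rewrite ?(negbTE an) //= mulr0 mul0r.
rewrite (bigD1_seq a) ?box_uniq //= eqxx mulr1 big1 ?addr0 // => e /negbTE ea.
by rewrite ea mulr0 mul0r; case: ifP.
Qed.

Fact smul1 : left_id (mon 0) smul.
Proof.
move=> f; apply: seriesP => c; rewrite (mon_box _ _ (inbox c)).
under [LHS]eq_bigr do rewrite add0r twist0l expr0z mul1r.
by rewrite (box_pick _ (inbox c)).
Qed.

Fact smulr1 : right_id (mon 0) smul.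
Proof.
move=> f; apply: seriesP => c; have cn := inbox c; rewrite (coefM _ _ cn).
transitivity (\sum_(a <- box (\max_v c v)) if a == c then coef f a else 0).
  rewrite !big_seq; apply: eq_bigr => a an.
  rewrite (bigD1_seq 0) ?box_uniq //=; last first.
    by rewrite mem_box; apply/forallP => v; rewrite ffunE.
  rewrite addr0 twist0r expr0z mul1r eqxx mulr1 big1 ?addr0 // => b /negbTE ->.
  by rewrite mulr0; case: ifP.
by rewrite (box_pick _ cn).
Qed.

Fact smulDl : left_distributive smul +%R.
Proof.
move=> f g h; apply: seriesP => c; rewrite coefD !(coefM _ _ (inbox c)).
rewrite -big_split; apply: eq_bigr => a _.
rewrite -big_split; apply: eq_bigr => b _ /=.
by case: ifP => _; rewrite ?addr0 // mulrDr mulrDl.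
Qed.

Fact smulDr : right_distributive smul +%R.
Proof.
move=> f g h; apply: seriesP => c; rewrite coefD !(coefM _ _ (inbox c)).
rewrite -big_split; apply: eq_bigr => a _.
rewrite -big_split; apply: eq_bigr => b _ /=.
by case: ifP => _; rewrite ?addr0 // mulrDr.
Qed.

Fact mon0_neq0 : mon 0 != 0.
Proof.
apply/eqP => /(congr1 (fun f => coef f 0)) /= /eqP.
by rewrite eqxx oner_eq0.
Qed.

HB.instance Definition _ :=
  GRing.Zmodule_isNzRing.Build S smulA smul1 smulr1 smulDl smulDr mon0_neq0.

Fact sscaleA (k l : R) f : sscale k (sscale l f) = sscale (k * l) f.
Proof. by apply: seriesP => a /=; rewrite mulrA. Qed.
Fact sscale1 : left_id 1 sscale.
Proof. by move=> f; apply: seriesP => a /=; rewrite mul1r. Qed.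
Fact sscaleDr : right_distributive sscale +%R.
Proof. by move=> k f g; apply: seriesP => a /=; rewrite mulrDr. Qed.
Fact sscaleDl f : {morph sscale^~ f : k l / k + l}.
Proof. by move=> k l; apply: seriesP => a /=; rewrite mulrDl. Qed.

HB.instance Definition _ :=
  GRing.Zmodule_isLmodule.Build R S sscaleA sscale1 sscaleDr sscaleDl.

Lemma coefZ (k : R) f a : coef (k *: f) a = k * coef f a. Proof. by []. Qed.

Fact sscaleAl (k : R) f g : k *: (f * g) = (k *: f) * g.
Proof.
apply: seriesP => c; rewrite coefZ !(coefM _ _ (inbox c)).
rewrite mulr_sumr; apply: eq_bigr => a _.
rewrite mulr_sumr; apply: eq_bigr => b _ /=.
by case: ifP => _; rewrite ?mulr0 // !mulrA [k * _]mulrC.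
Qed.

Fact sscaleAr (k : R) f g : k *: (f * g) = f * (k *: g).
Proof.
apply: seriesP => c; rewrite coefZ !(coefM _ _ (inbox c)).
rewrite mulr_sumr; apply: eq_bigr => a _.
rewrite mulr_sumr; apply: eq_bigr => b _ /=.
by case: ifP => _; rewrite ?mulr0 // mulrCA.
Qed.

HB.instance Definition _ := GRing.Lmodule_isLalgebra.Build R S sscaleAl.
HB.instance Definition _ := GRing.Lalgebra_isAlgebra.Build R S sscaleAr.

Lemma mon0 : mon 0 = 1. Proof. by []. Qed.

Lemma monM a b : mon a * mon b = q%:num ^ twist a b *: mon (a + b).
Proof.
apply: seriesP => c; rewrite coefZ (mon_box _ _ (inbox c)) /=.
have [->|cab] := eqVneq c (a + b).
  rewrite mulr1 (bigD1_seq b) ?box_uniq //=; last first.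
    by have /boxD/andP[] := inbox (a + b).
  rewrite !eqxx mulr1 big1 ?addr0 // => e /negbTE ->.
  by rewrite mulr0; case: ifP.
rewrite mulr0 big1 // => e _; case: eqP => // aec.
by case: eqP => [eb|]; rewrite ?mulr0 //; move: cab; rewrite -aec eb eqxx.
Qed.

End SeriesAlgebra.

Section Generators.
Context {R : realType} {q : {posnum R}} {N : nat}.
Implicit Types (u v : vertex N) (a b : expo N).

(* When [(i, j)] is not a vertex this is [1]. *)
Definition gen (i j : nat) : series q N :=
  mon [ffun v : vertex N => ((vi v == i) && (vj v == j) : nat)].

Definition vgen (v : vertex N) : series q N := gen (vi v) (vj v).

Definition delta (v : vertex N) : expo N := [ffun u => (u == v : nat)].

Lemma vertexE u v : (u == v) = (vi u == vi v) && (vj u == vj v).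
Proof.
by apply/eqP/andP => [->|[/eqP ij /eqP ij']] //; apply: val_inj;
  rewrite /= [vpair u]surjective_pairing [vpair v]surjective_pairing;
  congr pair; apply: val_inj.
Qed.

Lemma vgenE v : vgen v = mon (delta v).
Proof. by congr (mon _); apply/ffunP => u; rewrite !ffunE vertexE. Qed.

Lemma vlt_irr : irreflexive (@vlt N).
Proof. by move=> v; rewrite /vlt; lia. Qed.

Lemma vlt_trans : transitive (@vlt N).
Proof. by move=> v u w; rewrite /vlt; lia. Qed.

Lemma vlt_total u v : [|| u == v, vlt u v | vlt v u].
Proof. by rewrite vertexE /vlt; lia. Qed.

Lemma vle_total : total (@vle N).
Proof. by move=> u v; have := vlt_total u v; rewrite /vle eq_sym; lia. Qed.

Lemma vertices_uniq : uniq (vertices N).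
Proof. by rewrite sort_uniq enum_uniq. Qed.

Lemma mem_vertices v : v \in vertices N.
Proof. by rewrite mem_sort mem_enum. Qed.

Lemma vertices_sorted : sorted (@vlt N) (vertices N).
Proof.
have := vertices_uniq; have : sorted (@vle N) (vertices N) by apply: sort_sorted vle_total _.
rewrite (sorted_pairwise (leT := @vle N)); last first.
  move=> v u w; rewrite /vle !vertexE /vlt; lia.
rewrite uniq_pairwise (sorted_pairwise vlt_trans) => le_v ne_v.
have := pairwise_relI (@vle N) [rel x y | x != y] (vertices N).
rewrite le_v ne_v => le_ne.
apply: sub_pairwise le_ne => u v /andP[/orP[/eqP->|//]]; by rewrite /= eqxx.
Qed.

Lemma incidenceN u v : incidence u v = - incidence v u.
Proof.
rewrite /incidence; have : ~~ (edge u v && edge v u) by rewrite /edge; lia.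
by case: edge; case: edge; rewrite ?opprK ?oppr0.
Qed.

Lemma incidencevv v : incidence v v = 0.
Proof. by have := incidenceN v v; lia. Qed.

Lemma qpowD (x y : int) : q%:num ^ (x + y) = q%:num ^ x * q%:num ^ y :> R.
Proof. by rewrite expfzDr // gt_eqF. Qed.

(* In any algebra, the ordered monomials of a family that satisfies the defining
   relations of [T_N] multiply by the rule used in [smul]. *)
Section Ordered.
Variables (A : algType R) (z : vertex N -> A).
Hypothesis zC : forall u v, z u * z v = q%:num ^ incidence u v *: (z v * z u).

Definition omon a : A := \prod_(v <- vertices N) z v ^+ a v.

Lemma qcommX (x y : A) (k : int) (m n : nat) :
  x * y = q%:num ^ k *: (y * x) ->
  x ^+ m * y ^+ n = q%:num ^ (k * m * n) *: (y ^+ n * x ^+ m).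
Proof.
move=> xy.
have xyn j : x * y ^+ j = q%:num ^ (k * j) *: (y ^+ j * x).
  elim: j => [|j IH]; first by rewrite mulr0 expr0z scale1r !expr0 mul1r mulr1.
  rewrite exprS mulrA xy -scalerAl -[y * x * _]mulrA IH -scalerAr scalerA mulrA.
  by rewrite -qpowD; congr (_ ^ _ *: _); lia.
elim: m => [|m IH]; first by rewrite mulr0 mul0r expr0z scale1r !expr0 mul1r mulr1.
rewrite exprS -[x * _ * _]mulrA IH -scalerAr [x * (_ * _)]mulrA xyn.
rewrite -scalerAl scalerA -[y ^+ n * x * _]mulrA.
by rewrite -qpowD; congr (_ ^ _ *: _); lia.
Qed.

Lemma qcomm_prod (s : seq (vertex N)) a v n :
  (\prod_(u <- s) z u ^+ a u) * z v ^+ n =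
  q%:num ^ (\sum_(u <- s) incidence u v * (a u)%:Z * n%:Z) *:
    (z v ^+ n * \prod_(u <- s) z u ^+ a u).
Proof.
elim: s => [|u s IH]; first by rewrite !big_nil mul1r mulr1 expr0z scale1r.
rewrite !big_cons -mulrA IH -scalerAr [z u ^+ _ * (_ * _)]mulrA (qcommX _ _ (zC u v)).
by rewrite -scalerAl scalerA -[z v ^+ n * _ * _]mulrA -qpowD addrC.
Qed.

Lemma omonM a b : omon a * omon b = q%:num ^ twist a b *: omon (a + b).
Proof.
rewrite /omon /twist; have := vertices_sorted.
rewrite (sorted_pairwise vlt_trans).
elim: (vertices N) => [|v s IH] /=.
  by rewrite !big_nil mul1r expr0z scale1r.
case/andP => /allP vs /IH {}IH; rewrite !big_cons.
rewrite mulrA -[_ * \prod_(j <- s) _ * _]mulrA qcomm_prod.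
rewrite -scalerAr -scalerAl -!mulrA IH mulrA -exprD.
rewrite -scalerAr scalerA -qpowD expoD; congr (_ ^ _ *: _).
rewrite vlt_irr.
have -> : \sum_(j <- s | vlt j v) incidence v j * (a v)%:Z * (b j)%:Z = 0.
  rewrite big_seq_cond big_pred0 // => u; apply/negP => /andP[/vs vu uv].
  by have := vlt_trans uv vu; rewrite vlt_irr.
rewrite add0r -big_split /= !big_seq; apply: eq_bigr => u /vs vu.
by rewrite big_cons vu.
Qed.

Lemma omon_delta v : omon (delta v) = z v.
Proof.
rewrite /omon (eq_bigr (fun u => if u == v then z u else 1)) => [|u _].
  rewrite -big_mkcond -big_filter.
  by rewrite (filter_pred1_uniq vertices_uniq (mem_vertices v)) big_seq1.
by rewrite ffunE; case: eqP.
Qed.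

End Ordered.

Lemma twist_delta u v :
  twist (delta u) (delta v) = if vlt v u then incidence u v else 0.
Proof.
rewrite /twist (bigD1_seq u) ?mem_vertices ?vertices_uniq //=.
rewrite [X in _ + X]big1 ?addr0 => [|w /negbTE wu]; last first.
  by apply: big1 => x _; rewrite ffunE wu; lia.
rewrite big_mkcond (bigD1_seq v) ?mem_vertices ?vertices_uniq //=.
rewrite big1 ?addr0 => [|w /negbTE wv]; last first.
  by case: ifP => // _; rewrite [delta v w]ffunE wv; lia.
by rewrite !ffunE !eqxx !mulr1.
Qed.

Lemma vgenC u v : vgen u * vgen v = q%:num ^ incidence u v *: (vgen v * vgen u).
Proof.
rewrite !vgenE !monM [delta v + _]addrC scalerA -qpowD; congr (_ ^ _ *: _).
rewrite !twist_delta; case/or3P: (vlt_total u v) => [/eqP->|uv|vu].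
- by rewrite vlt_irr incidencevv.
- rewrite uv ifN ?[incidence v u]incidenceN ?subrr ?addrN //.
  by apply/negP => /(vlt_trans uv); rewrite vlt_irr.
- rewrite vu ifN ?addr0 //.
  by apply/negP => /(vlt_trans vu); rewrite vlt_irr.
Qed.

Lemma twist_eq0 a b :
  (forall u v, vlt v u -> (a u == 0) || (b v == 0)) -> twist a b = 0.
Proof.
move=> ab0; apply: big1 => u _; apply: big1 => v /ab0.
by case/orP => /eqP ->; rewrite ?mulr0 ?mul0r.
Qed.

Lemma deltaX v n u : (delta v *+ n) u = ((u == v) * n)%N.
Proof.
elim: n => [|n IH]; first by rewrite mulr0n ffunE muln0.
by rewrite mulrS expoD IH ffunE mulnS.
Qed.

Lemma vgenX v n : vgen v ^+ n = mon (delta v *+ n).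
Proof.
elim: n => [|n IH]; first by rewrite expr0 mulr0n mon0.
rewrite exprS IH vgenE monM mulrS twist_eq0 ?expr0z ?scale1r // => u w wu.
rewrite deltaX ffunE; have [uv|//] := eqVneq u v; have [wv|//] := eqVneq w v.
by move: wu; rewrite uv wv vlt_irr.
Qed.

Lemma monE a : mon a = omon vgen a.
Proof.
pose ar (s : seq (vertex N)) : expo N := [ffun v => if v \in s then a v else 0%N].
have -> : a = ar (vertices N) by apply/ffunP => v; rewrite ffunE mem_vertices.
rewrite /omon.
have -> : \prod_(v <- vertices N) vgen v ^+ ar (vertices N) v =
          \prod_(v <- vertices N) vgen v ^+ a v.
  by apply: eq_bigr => v _; rewrite ffunE mem_vertices.
have := vertices_sorted; rewrite (sorted_pairwise vlt_trans).
elim: (vertices N) => [|v s IH] /=.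
  by move=> _; rewrite big_nil -mon0; congr (mon _); apply/ffunP => v; rewrite !ffunE.
case/andP => /allP vs /IH {}IH; rewrite big_cons -IH vgenX monM.
rewrite twist_eq0 => [|u w wu]; last first.
  rewrite deltaX ffunE; have [uv|//] := eqVneq u v.
  case: ifP => [ws|_]; last by rewrite orbT.
  have vw := vs _ ws.
  by move: (vlt_trans vw wu); rewrite uv vlt_irr.
rewrite expr0z scale1r; congr (mon _); apply/ffunP => u.
rewrite expoD deltaX !ffunE in_cons; have [->|_] := eqVneq u v.
  case: ifP => [vin|_]; first by have := vs _ vin; rewrite vlt_irr.
  by rewrite mul1n addn0.
by rewrite mul0n.
Qed.

(* The image under [rho] of the generator [Z_v]. *)
Definition rgen (v : vertex N) : series q N := gen (vj v - vi v) (N.+1 - vi v).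

(* The continuous linear extension of [Z^a |-> \prod_v rho(Z_v) ^+ a v]; each
   coefficient of the value is a finitely supported sum. *)
Definition rho (f : series q N) : series q N := Series q N (fun c =>
  \sum_(a \in [set: expo N]) coef f a * coef (omon rgen a) c).

Fact vrot_subproof v : (vj v - vi v < N.+1)%N /\ (N.+1 - vi v < N.+1)%N.
Proof. by case: v => [[[i lti] [j ltj]]] /=; rewrite /vi /vj /=; lia. Qed.

Fact vrot_subproof2 v :
  (0 < (Ordinal (vrot_subproof v).1, Ordinal (vrot_subproof v).2).1
     < (Ordinal (vrot_subproof v).1, Ordinal (vrot_subproof v).2).2)%N.
Proof.
by move: (vrot_subproof v); case: v => [[[i lti] [j ltj]]] /=; rewrite /vi /vj /=; lia.
Qed.

Definition vrot v : vertex N := Vertex (vrot_subproof2 v).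

Lemma rgenE v : rgen v = vgen (vrot v). Proof. by []. Qed.

Lemma incidence_rot u v : incidence (vrot u) (vrot v) = incidence u v.
Proof.
have edge_rot x y : edge (vrot x) (vrot y) = edge x y.
  rewrite /edge /vrot /=; case: x y => [[[i1 ?] [j1 ?]] /= ?] [[[i2 ?] [j2 ?]] /= ?].
  by rewrite /vi /vj /=; lia.
by rewrite /incidence !edge_rot.
Qed.

Lemma rgenC u v : rgen u * rgen v = q%:num ^ incidence u v *: (rgen v * rgen u).
Proof. by rewrite !rgenE vgenC incidence_rot. Qed.

Definition deg a : nat := (\sum_v a v)%N.

Lemma degD a b : deg (a + b) = (deg a + deg b)%N.
Proof. by rewrite /deg -big_split; apply: eq_bigr => v _; rewrite expoD. Qed.

Lemma mem_box_deg n a : (deg a <= n)%N -> a \in box n.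
Proof.
move=> an; rewrite mem_box; apply/forallP => v; apply: leq_trans an.
by rewrite /deg (bigD1 v) //= leq_addr.
Qed.

Definition homog d (f : series q N) := forall c, coef f c != 0 -> deg c = d.

Lemma homogM d e (f g : series q N) :
  homog d f -> homog e g -> homog (d + e)%N (f * g).
Proof.
move=> fd ge c; rewrite (coefM _ _ (inbox c)); apply: contraNeq => dec.
rewrite big1 // => a _; rewrite big1 // => b _; case: eqP => // abc.
have [->|/fd ad] := eqVneq (coef f a) 0; first by rewrite mulr0 mul0r.
have [->|/ge be] := eqVneq (coef g b) 0; first by rewrite mulr0.
by move: dec; rewrite -abc degD ad be eqxx.
Qed.

Lemma homog1 : homog 0%N (1 : series q N).
Proof.
move=> c /=; have [->|_] := eqVneq c 0; last by rewrite eqxx.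
by move=> _; apply: big1 => v _; rewrite ffunE.
Qed.

Lemma homog_rgen v : homog 1%N (rgen v).
Proof.
rewrite rgenE vgenE => c /=; have [-> _|_] := eqVneq c _; last by rewrite eqxx.
rewrite /deg (bigD1 (vrot v)) //= ffunE eqxx big1 // => u /negbTE uv.
by rewrite ffunE uv.
Qed.

Lemma homog_omon_rgen a : homog (deg a) (omon rgen a).
Proof.
have -> : deg a = (\sum_(v <- vertices N) a v)%N.
  rewrite /deg /vertices [RHS](perm_big (enum {: vertex N})) /=; last by rewrite perm_sort.
  by rewrite big_enum.
apply: (big_ind2 homog) => [|d f e g|v _]; [exact: homog1|exact: homogM|].
elim: (a v) => [|n IH]; first by rewrite expr0; exact: homog1.
by rewrite exprS -add1n; apply: homogM => //; exact: homog_rgen.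
Qed.

Lemma coef_rho n f c : (deg c <= n)%N ->
  coef (rho f) c = \sum_(a <- box n) coef f a * coef (omon rgen a) c.
Proof.
move=> cn; rewrite /= (fsbigE (box n)) ?box_uniq //.
  by apply: eq_bigl => a; exact: mem_set.
move=> a _ an; have [->|/homog_omon_rgen ac] := eqVneq (coef (omon rgen a) c) 0.
  by rewrite mulr0.
by move: an; rewrite mem_box_deg // -ac.
Qed.

Fact rho_is_linear : linear rho.
Proof.
move=> k f g; apply: seriesP => c; rewrite coefD coefZ !(coef_rho _ (leqnn _)).
rewrite mulr_sumr -big_split; apply: eq_bigr => a _.
by rewrite coefD coefZ mulrDl mulrA.
Qed.

Lemma rho_mon a : rho (mon a) = omon rgen a.
Proof.
apply: seriesP => c; rewrite (coef_rho _ (leq_maxl (deg c) (deg a))).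
rewrite (bigD1_seq a) ?box_uniq ?mem_box_deg ?leq_maxr //= eqxx mul1r.
by rewrite big1 ?addr0 // => b /negbTE ->; rewrite mul0r.
Qed.

Fact rho_is_monoid_morphism : monoid_morphism rho.
Proof.
split.
  by rewrite -mon0 rho_mon; apply: big1 => v _; rewrite ffunE.
move=> f g; apply: seriesP => c; set n := deg c.
have cn : c \in box n by exact: mem_box_deg.
transitivity (\sum_(a <- box n) \sum_(b <- box n)
    coef f a * coef g b * coef (omon rgen a * omon rgen b) c).
  rewrite (coef_rho _ (leqnn _)) -/n.
  transitivity (\sum_(e <- box n) \sum_(a <- box n) \sum_(b <- box n)
    if e == a + b then coef f a * coef g b * coef (omon rgen a * omon rgen b) c
    else 0).
    rewrite !big_seq; apply: eq_bigr => e en; rewrite (coefM _ _ en).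
    rewrite mulr_suml; apply: eq_bigr => a _.
    rewrite mulr_suml; apply: eq_bigr => b _; rewrite eq_sym.
    case: eqP => [->|_]; last by rewrite mul0r.
    by rewrite (omonM rgenC) coefZ; set x := (q%:num ^ _); set y := coef _ c; ring.
  rewrite exchange_big; apply: eq_bigr => a _.
  rewrite exchange_big; apply: eq_bigr => b _.
  have [abn|abn] := boolP (a + b \in box n); first by rewrite box_pick_cst.
  rewrite (omonM rgenC) coefZ; set y := coef _ c; have -> : y = 0.
    apply/eqP; apply: contraNT abn => /homog_omon_rgen ac.
    by apply: mem_box_deg; rewrite -ac.
  by rewrite !mulr0 big1 // => e _; case: ifP.
rewrite (coefM _ _ cn).
transitivity (\sum_(a <- box n) \sum_(b <- box n) \sum_(d <- box n)
    \sum_(e <- box n) if d + e == c then q%:num ^ twist d e *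
      (coef f a * coef (omon rgen a) d) * (coef g b * coef (omon rgen b) e) else 0).
  apply: eq_bigr => a _; apply: eq_bigr => b _; rewrite (coefM _ _ cn).
  rewrite mulr_sumr; apply: eq_bigr => d _.
  rewrite mulr_sumr; apply: eq_bigr => e _; case: ifP => _; last by rewrite mulr0.
  by set x := (q%:num ^ _); set y := coef (omon _ _) _; set z := coef (omon _ _) _; ring.
under eq_bigr do rewrite exchange_big.
rewrite exchange_big; apply: eq_bigr => d _.
under eq_bigr do rewrite exchange_big.
rewrite exchange_big; apply: eq_bigr => e _.
case: eqP => [dec|_]; last by rewrite big1 // => a _; rewrite big1.
have [dn en] : (deg d <= n /\ deg e <= n)%N by rewrite /n -dec degD leq_addr leq_addl.
rewrite (coef_rho _ dn) (coef_rho _ en) [RHS]mulr_sumr exchange_big.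
by apply: eq_bigr => b _; rewrite mulr_sumr mulr_suml.
Qed.

HB.instance Definition _ := GRing.isLinear.Build R (series q N) (series q N) *:%R
  rho rho_is_linear.
HB.instance Definition _ := GRing.isMonoidMorphism.Build (series q N) (series q N)
  rho rho_is_monoid_morphism.

Lemma rho_gen (i j : nat) : (0 < i < j)%N -> (j <= N)%N ->
  rho (gen i j) = gen (j - i) (N.+1 - i).
Proof.
move=> ij jN; have iN : (i < N.+1)%N by lia.
have jN' : (j < N.+1)%N by lia.
pose v : vertex N := @Vertex N (Ordinal iN, Ordinal jN') ij.
by rewrite -[gen i j]/(vgen v) vgenE rho_mon omon_delta.
Qed.

(* The coefficientwise sum has finite support as soon as [x] has no constant
   term; [\sum_(n \in _)] is [0] on infinite supports. *)
Definition qexp (x : series q N) : series q N := Series q N (fun c =>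
  \sum_(n \in [set: nat])
     coef ((- x) ^+ n) c / \prod_(1 <= k < n.+1) (1 - q%:num ^+ k)).

Lemma coef_qexp d x c : (0 < d)%N -> homog d x ->
  coef (qexp x) c = \sum_(0 <= n < (deg c).+1)
     coef ((- x) ^+ n) c / \prod_(1 <= k < n.+1) (1 - q%:num ^+ k).
Proof.
move=> d_gt0 xd; rewrite /= (fsbigE (index_iota 0 (deg c).+1)) ?iota_uniq //.
  by apply: eq_bigl => n; exact: mem_set.
move=> n _; rewrite mem_index_iota /= -leqNgt => cn.
have xnd m : homog (m * d)%N ((- x) ^+ m).
  elim: m => [|m IH]; first by rewrite expr0; exact: homog1.
  rewrite exprS mulSn; apply: homogM => // a.
  by rewrite -scaleN1r coefZ mulN1r oppr_eq0; exact: xd.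
have [->|/xnd cnd] := eqVneq (coef ((- x) ^+ n) c) 0; first by rewrite mul0r.
by move: cn; rewrite cnd ltnNge leq_pmulr.
Qed.

(* For a monomial [x], this says that the generator [Z_v] occurs in [x]. *)
Definition occurs (v : vertex N) (x : series q N) : bool :=
  `[< exists2 a : expo N, coef x a != 0 & (0 < a v)%N >].

(* [l = (a, b, c)] *)
Definition mlambda (l : nat * nat * nat) : series q N :=
  \prod_(0 <= k < l.2 - l.1.2) gen (l.1.1 + k) (l.1.2 + k).

End Generators.

Arguments gen {R} q N i j.
Arguments mlambda {R} q N l.

(* In increasing lexicographic order. *)
Definition Lambda (N : nat) : seq (nat * nat * nat) :=
  flatten [seq flatten [seq [seq (a, b, c) | c <- index_iota b.+1 N.+2]
                           | b <- index_iota a.+1 N.+2]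
              | a <- index_iota 1 N.+2].

(* With [I] empty this is the product of the [qexp (rho^s(m_lambda))]. The
   factors that involve a generator [Z_v] with [v] in [I] are replaced by [1]. *)
Definition Tred (R : realType) (q : {posnum R}) (N : nat) (I : {set vertex N})
    (s : nat) : series q N :=
  \prod_(l <- Lambda N)
    if [exists v in I, occurs v (iter s rho (mlambda q N l))] then 1
    else qexp (iter s rho (mlambda q N l)).

(* Main.v *)
(* Killing the generators [Z_v] with [v] in [I] is an algebra morphism of the
   completion, and maps the product of all the quantum exponentials to the reduced
   one. As [rho] is an automorphism, it remains to prove [T = rho(T)].

   The monomials of [T] are the products along diagonal segments of the quiver,
   those of [rho(T)] the products along row segments. Since
   [<x> <y> = <x + y>] for [y x = q x y], the factors of [rho(T)] merge into
   exponentials of row sums [X_i^M], [M] decreasing, which satisfy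
   [X_i^(M+1) = Z_(i,M+1) (1 + X_i^M)]; after exchanging commuting factors, those of
   [T] merge into exponentials of diagonal sums [Y_i^M], [M] increasing, which
   satisfy [Y_i^(M+1) = (1 + Y_(i-1)^M) Z_(i,M+1)]. If [U_M] is the product of the
   [<Y_i^m>] with [m <= M], then [X_i^(M+1) U_M = U_M Y_i^(M+1)], hence
   [<X_i^(M+1)> U_M = U_M <Y_i^(M+1)>], and both products agree by induction on [M].
   The intertwining relation reduces to
   [Z (1 + v) <u> <v> = <u> <v> (1 + u) Z] for [u = Y_(i-1)^M], [v = Y_i^M] and
   [Z = Z_(i,M+1)], which holds because the [q]-commutator of [u] and [v] commutes
   with [u] and [v]. *)
From mathcomp Require Import all_boot all_order all_algebra.
From mathcomp Require Import boolp classical_sets fsbigop.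
From mathcomp Require Import reals interval_inference.
From mathcomp Require Import zify lra ring.
Require Import Defs.

Set Implicit Arguments.
Unset Strict Implicit.
Unset Printing Implicit Defensive.

Import Order.TTheory GRing.Theory Num.Theory.
Local Open Scope ring_scope.

(** * Agreement of series up to a given degree *)

Section Filtration.
Context {R : realType} {q : {posnum R}} {N : nat}.
Notation S := (series q N).
Implicit Types (f g h x y : S) (n m : nat).

Definition eqdeg n f g := forall c, (deg c < n)%N -> coef f c = coef g c.

(** The convergence condition for [qexp]. Unlike [homog], it covers sums of monomials of different
    degrees. *)
Definition small x := coef x 0 = 0.

Lemma deg0 : deg (0 : expo N) = 0%N.
Proof. by apply: big1 => v _; rewrite ffunE. Qed.

Lemma deg_eq0 (c : expo N) : deg c = 0%N -> c = 0.
Proof.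
move=> /eqP; rewrite /deg sum_nat_eq0 => /forallP c0; apply/ffunP => v.
by rewrite ffunE; have /eqP := c0 v.
Qed.

Lemma eqdegP f g : (forall n, eqdeg n f g) -> f = g.
Proof. by move=> fg; apply: seriesP => c; apply: (fg (deg c).+1). Qed.

Lemma eqdeg_refl n f : eqdeg n f f. Proof. by []. Qed.

Lemma eqdeg_sym n f g : eqdeg n f g -> eqdeg n g f.
Proof. by move=> fg c cn; rewrite fg. Qed.

Lemma eqdeg_trans n f g h : eqdeg n f g -> eqdeg n g h -> eqdeg n f h.
Proof. by move=> fg gh c cn; rewrite fg // gh. Qed.

Lemma eqdegW n m f g : (n <= m)%N -> eqdeg m f g -> eqdeg n f g.
Proof. by move=> nm fg c cn; apply: fg; apply: leq_trans nm. Qed.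

Lemma eqdegD n f g f' g' : eqdeg n f f' -> eqdeg n g g' -> eqdeg n (f + g) (f' + g').
Proof. by move=> ff gg c cn; rewrite !coefD ff // gg. Qed.

Lemma eqdegZ n (k : R) f f' : eqdeg n f f' -> eqdeg n (k *: f) (k *: f').
Proof. by move=> ff c cn; rewrite !coefZ ff. Qed.

Lemma eqdeg_sum n I (r : seq I) (P : pred I) (F G : I -> S) :
  (forall i, P i -> eqdeg n (F i) (G i)) ->
  eqdeg n (\sum_(i <- r | P i) F i) (\sum_(i <- r | P i) G i).
Proof. by move=> FG; apply: (big_ind2 (eqdeg n)) => // *; exact: eqdegD. Qed.

Lemma eqdeg_sum_nat n m p (F G : nat -> S) :
  (forall i, (m <= i < p)%N -> eqdeg n (F i) (G i)) ->
  eqdeg n (\sum_(m <= i < p) F i) (\sum_(m <= i < p) G i).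
Proof. by move=> FG; rewrite !big_nat; apply: eqdeg_sum. Qed.

Lemma coefM_eq f g f' g' c :
  (forall a b, a + b = c -> coef f a * coef g b = coef f' a * coef g' b) ->
  coef (f * g) c = coef (f' * g') c.
Proof.
move=> H; rewrite !(coefM _ _ (inbox c)); apply: eq_bigr => a _.
by apply: eq_bigr => b _; case: eqP => // abc; rewrite -!mulrA H.
Qed.

Lemma eqdegM n f g f' g' : eqdeg n f f' -> eqdeg n g g' -> eqdeg n (f * g) (f' * g').
Proof.
move=> ff gg c cn; apply: coefM_eq => a b abc.
have [an bn] : (deg a < n /\ deg b < n)%N by move: cn; rewrite -abc degD; lia.
by rewrite ff // gg.
Qed.

(** Orders of vanishing add: if a total degree is below n + m, one of the two factors is below its
    own bound. *)
Lemma eqdeg0M n m f g : eqdeg n f 0 -> eqdeg m g 0 -> eqdeg (n + m) (f * g) 0.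
Proof.
move=> f0 g0 c cn; rewrite -(mul0r (0 : S)); apply: coefM_eq => a b abc.
have [an|bm] : (deg a < n)%N \/ (deg b < m)%N by move: cn; rewrite -abc degD; lia.
  by rewrite f0 // coef0 !mul0r.
by rewrite g0 // coef0 !mulr0.
Qed.

Lemma coefN f c : coef (- f) c = - coef f c.
Proof. by []. Qed.

Lemma smallE x : small x <-> eqdeg 1 x 0.
Proof.
split=> [x0 c c0|]; last by move=> /(_ 0); rewrite deg0; apply.
by rewrite [c]deg_eq0 //; lia.
Qed.

Lemma eqdeg0X n x : small x -> eqdeg n (x ^+ n) 0.
Proof.
move/smallE => x0; elim: n => [|n IH]; first by move=> c.
by rewrite exprS -add1n; apply: eqdeg0M.
Qed.

Lemma small0 : small 0. Proof. by []. Qed.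

Lemma smallD x y : small x -> small y -> small (x + y).
Proof. by rewrite /small coefD => -> ->; rewrite addr0. Qed.

Lemma smallN x : small x -> small (- x).
Proof. by rewrite /small -scaleN1r coefZ => ->; rewrite mulr0. Qed.

Lemma smallZ (k : R) x : small x -> small (k *: x).
Proof. by rewrite /small coefZ => ->; rewrite mulr0. Qed.

Lemma smallMl x y : small x -> small (x * y).
Proof.
by move=> /smallE x0; apply/smallE; rewrite -[1%N]addn0; apply: eqdeg0M => // c.
Qed.

Lemma smallMr x y : small y -> small (x * y).
Proof.
by move=> /smallE x0; apply/smallE; rewrite -[1%N]add0n; apply: eqdeg0M => // c.
Qed.

Lemma small_sum I (r : seq I) (P : pred I) (F : I -> S) :
  (forall i, P i -> small (F i)) -> small (\sum_(i <- r | P i) F i).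
Proof. by move=> F0; apply: big_ind => //; exact: smallD. Qed.

End Filtration.

(** * The quantum exponential: functional equation and addition formula *)

Section QExp.
Context {R : realType} {q : {posnum R}} {N : nat}.
Context (hq : q%:num < 1).
Notation S := (series q N).
Notation Q := (q%:num).
Implicit Types (f g h x y u w : S) (n m : nat).

Definition qfact n : R := \prod_(1 <= k < n.+1) (1 - Q ^+ k).

Definition qterm n x : S := locked ((qfact n)^-1 *: (- x) ^+ n).

Lemma qtermE n x : qterm n x = (qfact n)^-1 *: (- x) ^+ n.
Proof. by rewrite /qterm -lock. Qed.

Lemma qexpn_lt1 k : (0 < k)%N -> 1 - Q ^+ k != 0.
Proof. by move=> k0; rewrite subr_eq0 gt_eqF // exprn_ilt1 // -lt0n. Qed.

Lemma qfactS n : qfact n.+1 = qfact n * (1 - Q ^+ n.+1).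
Proof. by rewrite /qfact big_nat_recr. Qed.

Lemma qfact0 : qfact 0 = 1.
Proof. by rewrite /qfact big_geq. Qed.

Lemma qterm0 x : qterm 0 x = 1.
Proof. by rewrite !qtermE qfact0 invr1 scale1r expr0. Qed.

(** With [qterm0], this recurrence determines the terms: the factor 1 - q^(n+1) can be cancelled
    because q < 1. *)
Lemma qtermS n x : (1 - Q ^+ n.+1) *: qterm n.+1 x = - (x * qterm n x).
Proof.
rewrite !qtermE scalerA qfactS invfM mulrCA mulfV ?qexpn_lt1 // mulr1.
by rewrite exprS mulNr scalerN -scalerAr.
Qed.

Lemma qtermSr n x : (1 - Q ^+ n.+1) *: qterm n.+1 x = - (qterm n x * x).
Proof.
rewrite qtermS !qtermE -scalerAr -scalerAl -[x]opprK mulNr mulrN opprK.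
by rewrite -exprS exprSr.
Qed.

Lemma eqdeg_qterm n x : small x -> eqdeg n (qterm n x) 0.
Proof.
move=> x0 c cn; rewrite qtermE coefZ (eqdeg0X (smallN x0) cn) coef0.
by rewrite mulr0.
Qed.

(** Terms of index at least n vanish below degree n. Leaving m free allows one extra term where a
    sum is shifted by one. *)
Lemma qexpE n m x : small x -> (n <= m)%N ->
  eqdeg n (qexp x) (\sum_(0 <= k < m) qterm k x).
Proof.
move=> x0 nm c cn; rewrite /= (fsbigE (index_iota 0 m)) ?iota_uniq //.
  rewrite (big_morph (fun f : S => coef f c) (fun f g => coefD f g c) (coef0 c)).
  under eq_bigl do rewrite mem_set //.
  by apply: eq_bigr => k _; rewrite qtermE coefZ mulrC.
move=> k _; rewrite mem_index_iota /= -leqNgt => mk.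
rewrite (eqdeg0X (smallN x0)) ?coef0 ?mul0r //.
by apply: leq_trans cn _; apply: leq_trans mk.
Qed.

Lemma qexp0 : qexp (0 : S) = 1.
Proof.
apply: eqdegP => n; apply: eqdeg_trans (qexpE (m := n.+1) small0 (leqnSn n)) _.
rewrite big_nat_recl // qterm0 big1 ?addr0 // => k _.
by rewrite !qtermE oppr0 expr0n /= scaler0.
Qed.

Lemma qexp_intertwine x y g : small x -> small y ->
  x * g = g * y -> qexp x * g = g * qexp y.
Proof.
move=> x0 y0 xg; apply: eqdegP => n.
apply: eqdeg_trans (eqdegM (qexpE x0 (leqnn n)) (eqdeg_refl g)) _.
apply/eqdeg_sym/(eqdeg_trans (eqdegM (eqdeg_refl g) (qexpE y0 (leqnn n)))).
rewrite mulr_suml mulr_sumr => c _; congr coef; apply: eq_bigr => k _.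
rewrite !qtermE -scalerAr -scalerAl; congr (_ *: _).
elim: k => [|k IH]; first by rewrite !expr0 mul1r mulr1.
by rewrite !exprS -[RHS]mulrA -IH !mulrA mulrN !mulNr xg.
Qed.

Lemma qexp_comm x g : small x -> x * g = g * x -> qexp x * g = g * qexp x.
Proof. by move=> x0; apply: qexp_intertwine. Qed.

Lemma qexp_comm2 x y : small x -> small y -> x * y = y * x ->
  qexp x * qexp y = qexp y * qexp x.
Proof. by move=> x0 y0 xy; apply: qexp_comm => //; symmetry; apply: qexp_comm. Qed.

Lemma qtermZ k x : qterm k (Q *: x) = Q ^+ k *: qterm k x.
Proof. by rewrite !qtermE -scalerN exprZn !scalerA mulrC. Qed.

(** For t_k = [qterm k x], the recurrence reads q^k t_k = t_k + x t_(k-1). *)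
Lemma qexp_scale x : small x -> qexp (Q *: x) = (1 + x) * qexp x.
Proof.
move=> x0; apply: eqdegP => n; have qx0 := smallZ Q x0.
apply: eqdeg_trans (qexpE (m := n.+1) qx0 (leqnSn n)) _; apply: eqdeg_sym.
rewrite mulrDl mul1r.
apply: eqdeg_trans (eqdegD (qexpE (m := n.+1) x0 (leqnSn n))
   (eqdegM (eqdeg_refl x) (qexpE x0 (leqnn n)))) _.
move=> c _; congr coef; rewrite !big_nat_recl // !qterm0 -addrA; congr (_ + _).
rewrite mulr_sumr -big_split /=; apply: eq_bigr => k _.
rewrite qtermZ -[x * _]opprK -qtermS -scaleNr -[X in X + _]scale1r -scalerDl.
by congr (_ *: _); ring.
Qed.

Lemma qexp_scaler x : small x -> qexp (Q *: x) = qexp x * (1 + x).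
Proof.
by move=> x0; rewrite qexp_scale // mulrDl mulrDr mul1r mulr1 qexp_comm.
Qed.

Lemma qterm_comm_scale n x y : y * x = Q *: (x * y) ->
  y * qterm n x = Q ^+ n *: (qterm n x * y).
Proof.
move=> yx; rewrite !qtermE -scalerAr -scalerAl scalerA [_ * (qfact n)^-1]mulrC.
rewrite -scalerA; congr (_ *: _).
elim: n => [|n IH]; first by rewrite !expr0 mul1r mulr1 scale1r.
rewrite exprSr mulrA IH -scalerAl -!mulrA mulrN yx mulNr -scalerN -scalerAr.
by rewrite scalerA exprSr.
Qed.

(* Both sides satisfy [(1 - q^n) F_n = - (x + y) F_(n - 1)]. *)
Lemma qtermD n x y : y * x = Q *: (x * y) ->
  qterm n (x + y) = \sum_(0 <= k < n.+1) qterm k x * qterm (n - k) y.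
Proof.
move=> yx; elim: n => [|n IH].
  by rewrite big_nat1 !qterm0 mulr1.
apply: (scalerI (qexpn_lt1 (ltn0Sn n))); rewrite qtermS IH scaler_sumr.
(* Splits 1 - q^(n+1) = (1 - q^k) + q^k (1 - q^(n+1-k)). The first part lowers the index of the term
   in x; the second lowers that of the term in y, and its q^k is absorbed by moving y left across
   [qterm k x]. *)
rewrite [RHS](eq_big_nat _ _ (F2 := fun k => (1 - Q ^+ k) *: qterm k x * qterm (n.+1 - k) y
   + Q ^+ k *: qterm k x * ((1 - Q ^+ (n.+1 - k)) *: qterm (n.+1 - k) y))); last first.
  move=> k /andP[_ kn] /=; move: (qterm k x) (qterm _ y) => f g.
  rewrite -!scalerAl -scalerAr scalerA -scalerDl.
  congr (_ *: _); have -> : Q ^+ n.+1 = Q ^+ k * Q ^+ (n.+1 - k).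
    by rewrite -exprD subnKC.
  by ring.
rewrite big_split /= mulrDl opprD; congr (_ + _).
  rewrite [RHS]big_nat_recl // expr0 subrr scale0r mul0r add0r mulr_sumr -sumrN.
  by apply: eq_bigr => k _; rewrite qtermS mulNr mulrA subSS.
rewrite [RHS]big_nat_recr // subnn /= subrr scale0r mulr0 addr0 mulr_sumr -sumrN.
rewrite !big_nat; apply: eq_bigr => k /andP[_ kn]; rewrite subSn // qtermS mulrN.
rewrite !mulrA (qterm_comm_scale _ yx); move: (qterm k x) (qterm _ y) => f g.
by rewrite -!scalerAl.
Qed.

Lemma sum_triangle (V : nmodType) n (F : nat -> nat -> V) :
  \sum_(0 <= m < n) \sum_(0 <= k < m.+1) F k (m - k)%N =
  \sum_(0 <= k < n) \sum_(0 <= l < n - k) F k l.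
Proof.
elim: n => [|n IH]; first by rewrite !big_geq.
rewrite big_nat_recr //= IH [RHS]big_nat_recr //= subSnn big_nat1.
rewrite [X in _ + X]big_nat_recr //= subnn addrA; congr (_ + _).
rewrite -big_split !big_nat; apply: eq_bigr => k /andP[_ kn].
by rewrite subSn ?(ltnW kn) // big_nat_recr.
Qed.

Lemma qexpD x y : small x -> small y -> y * x = Q *: (x * y) ->
  qexp x * qexp y = qexp (x + y).
Proof.
move=> x0 y0 yx; apply: eqdegP => n.
apply: eqdeg_trans (eqdegM (qexpE x0 (leqnn n)) (qexpE y0 (leqnn n))) _.
apply: eqdeg_sym; refine (eqdeg_trans (qexpE (smallD x0 y0) (leqnn n)) _).
rewrite (eq_bigr _ (fun m _ => qtermD m yx)).
rewrite (sum_triangle n (fun k l => qterm k x * qterm l y)) mulr_suml.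
apply: eqdeg_sum_nat => k /andP[_ kn].
(* The square of index pairs exceeds the triangle k + l < n only by terms that vanish below degree
   n. *)
have -> : \sum_(0 <= l < n) qterm l y =
    \sum_(0 <= l < n - k) qterm l y + \sum_(n - k <= l < n) qterm l y.
  by rewrite (@big_cat_nat _ _ _ (n - k)) ?leq_subr.
rewrite mulrDr !mulr_sumr; set A := \sum_(0 <= l < _) _.
suff E : eqdeg n 0 (\sum_(n - k <= l < n) qterm k x * qterm l y).
  by have := eqdegD (eqdeg_refl A) E; rewrite addr0.
apply: eqdeg_sym; rewrite big_nat.
apply: (big_ind (fun f => eqdeg n f 0)) => // [f g f0 g0|l /andP[kl _]].
  by have := eqdegD f0 g0; rewrite addr0.
apply: (eqdegW (m := k + l)); first by lia.
by apply: eqdeg0M; exact: eqdeg_qterm.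
Qed.

(** * Exponentials of two series whose q-commutator commutes with both *)

Section Heisenberg.
Context (u w c : S) (u0 : small u) (w0 : small w).
Context (uw : u * w = Q *: (w * u) + c) (cu : c * u = u * c) (cw : c * w = w * c).

Let k := (1 - Q)^-1.

Let q1 : 1 - Q != 0.
Proof. exact: (@qexpn_lt1 1). Qed.

(** Moving w across u^(n+1) leaves (1 + q + ... + q^n) c u^n. This q-integer is k (1 - q^(n+1)),
    which cancels the last factor of [qfact n.+1]. *)
Lemma heisenberg_qterml n : qterm n.+1 u * w =
  Q ^+ n.+1 *: (w * qterm n.+1 u) - k *: (c * qterm n u).
Proof.
(* [t n] stands for the term of index n - 1, with value 0 at n = 0, so that the induction starts at
   the empty power. *)
pose t n := if n is m.+1 then qterm m u else 0 : S.
have tE m : (1 - Q ^+ m) *: qterm m u = - (u * t m).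
  by case: m => [|m]; rewrite ?qtermS // expr0 subrr scale0r mulr0 oppr0.
rewrite -/(t n.+1); elim: {n}n.+1 => [|n IH].
  by rewrite !qterm0 expr0 mulr0 scaler0 subr0 mulr1 mul1r scale1r.
apply: (scalerI (qexpn_lt1 (ltn0Sn n))).
rewrite scalerAl qtermS mulNr -mulrA IH.
have -> : u * (Q ^+ n *: (w * qterm n u) - k *: (c * t n)) =
    Q ^+ n *: ((u * w) * qterm n u) + k *: (c * - (u * t n)).
  move: (qterm n u) (t n) => f g.
  by rewrite mulrBr -!scalerAr mulrN scalerN !mulrA cu.
rewrite -tE uw [t n.+1]/=; have := qtermS n u.
move: (qterm n.+1 u) (qterm n u) => f' f f'E.
rewrite mulrDl -!scalerAr -!scalerAl scalerBr.
have -> : (1 - Q ^+ n.+1) *: (Q ^+ n.+1 *: (w * f')) =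
    - (Q ^+ n.+1 *: ((w * u) * f)).
  rewrite scalerA mulrC -scalerA scalerAr f'E mulrN scalerN.
  by rewrite mulrA.
apply: seriesP => a; rewrite !(coefD, coefN, coefZ, exprS).
by rewrite /k; field.
Qed.

Lemma heisenberg_qtermr n : u * qterm n.+1 w =
  Q ^+ n.+1 *: (qterm n.+1 w * u) - k *: (c * qterm n w).
Proof.
pose t n := if n is m.+1 then qterm m w else 0 : S.
have tE m : (1 - Q ^+ m) *: qterm m w = - (t m * w).
  by case: m => [|m]; rewrite ?qtermSr // expr0 subrr scale0r mul0r oppr0.
rewrite -/(t n.+1); elim: {n}n.+1 => [|n IH].
  by rewrite !qterm0 expr0 mulr0 scaler0 subr0 mulr1 mul1r scale1r.
apply: (scalerI (qexpn_lt1 (ltn0Sn n))).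
rewrite scalerAr qtermSr mulrN mulrA IH.
have -> : (Q ^+ n *: (qterm n w * u) - k *: (c * t n)) * w =
    Q ^+ n *: (qterm n w * (u * w)) + k *: (c * - (t n * w)).
  move: (qterm n w) (t n) => f g.
  by rewrite mulrBl -!scalerAl mulrN scalerN !mulrA.
have ct m : qterm m w * c = c * qterm m w.
  rewrite !qtermE -scalerAr -scalerAl; congr (_ *: _).
  by apply/esym/commrX/commrN.
rewrite -tE uw mulrDr ct [t n.+1]/=; have := qtermSr n w.
move: (qterm n.+1 w) (qterm n w) => f' f f'E.
rewrite -!scalerAr scalerBr.
have -> : (1 - Q ^+ n.+1) *: (Q ^+ n.+1 *: (f' * u)) =
    - (Q ^+ n.+1 *: (f * (w * u))).
  rewrite scalerA mulrC -scalerA scalerAl f'E mulNr scalerN.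
  by rewrite mulrA.
apply: seriesP => a; rewrite !(coefD, coefN, coefZ, exprS).
by rewrite /k; field.
Qed.

(** Sum of [heisenberg_qterml] over n: the corrections add up to - k c <u>, and q^n is absorbed into
    the argument q u. *)
Lemma heisenbergl : qexp u * (w + k *: c) = w * qexp (Q *: u).
Proof.
have cE : qexp u * c = c * qexp u by apply: qexp_comm.
rewrite mulrDr -scalerAr cE; apply: eqdegP => n.
apply: eqdeg_trans (eqdegD (eqdegM (qexpE (m := n.+1) u0 (leqnSn n)) (eqdeg_refl w))
  (eqdegZ k (eqdegM (eqdeg_refl c) (qexpE u0 (leqnn n))))) _.
apply/eqdeg_sym/(eqdeg_trans (eqdegM (eqdeg_refl w)
  (qexpE (m := n.+1) (smallZ Q u0) (leqnSn n)))) => a _; congr coef.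
rewrite mulr_sumr mulr_suml !big_nat_recl // !qterm0 mul1r mulr1 -addrA; congr (_ + _).
rewrite mulr_sumr scaler_sumr -big_split; apply: eq_bigr => i _ /=.
by rewrite heisenberg_qterml qtermZ scalerAr subrK.
Qed.

Lemma heisenbergr : (u + k *: c) * qexp w = qexp (Q *: w) * u.
Proof.
rewrite mulrDl -scalerAl; apply: eqdegP => n.
apply: eqdeg_trans (eqdegD (eqdegM (eqdeg_refl u) (qexpE (m := n.+1) w0 (leqnSn n)))
  (eqdegZ k (eqdegM (eqdeg_refl c) (qexpE w0 (leqnn n))))) _.
apply/eqdeg_sym/(eqdeg_trans (eqdegM 
  (qexpE (m := n.+1) (smallZ Q w0) (leqnSn n)) (eqdeg_refl u))) => a _; congr coef.
rewrite mulr_sumr mulr_suml !big_nat_recl // !qterm0 mul1r mulr1 -addrA; congr (_ + _).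
rewrite mulr_sumr scaler_sumr -big_split; apply: eq_bigr => i _ /=.
by rewrite heisenberg_qtermr qtermZ scalerAl subrK.
Qed.

End Heisenberg.
End QExp.

(** * Commutation up to a scalar *)

Section QCommutation.
Context {R : realType} {q : {posnum R}} {N : nat}.
Notation S := (series q N).
Notation Q := (q%:num).
Implicit Types (x y f g : S) (k l : R).

Definition qcomm k x y := x * y = k *: (y * x).

Lemma qcommMr k l x y f : qcomm k x y -> qcomm l x f -> qcomm (k * l) x (y * f).
Proof.
rewrite /qcomm => xy xf.
by rewrite mulrA xy -scalerAl -[y * x * f]mulrA xf -scalerAr scalerA mulrA.
Qed.

Lemma qcommMl k l x y f : qcomm k x f -> qcomm l y f -> qcomm (k * l) (x * y) f.
Proof.
rewrite /qcomm => xf yf.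
rewrite -mulrA yf -scalerAr [x * (f * y)]mulrA xf -scalerAl scalerA -mulrA.
by rewrite [l * k]mulrC.
Qed.

Lemma qcomm1r x : qcomm 1 x 1. Proof. by rewrite /qcomm mulr1 mul1r scale1r. Qed.
Lemma qcomm1l x : qcomm 1 1 x. Proof. by rewrite /qcomm mulr1 mul1r scale1r. Qed.
Lemma qcomm0r k x : qcomm k x 0. Proof. by rewrite /qcomm mulr0 mul0r scaler0. Qed.
Lemma qcomm0l k x : qcomm k 0 x. Proof. by rewrite /qcomm mulr0 mul0r scaler0. Qed.

Lemma qcomm1E x y : qcomm 1 x y <-> x * y = y * x.
Proof. by rewrite /qcomm scale1r. Qed.

Lemma qcomm1_sym x y : qcomm 1 x y -> qcomm 1 y x.
Proof. by rewrite !qcomm1E => ->. Qed.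

Lemma qcommDr k x y f : qcomm k x y -> qcomm k x f -> qcomm k x (y + f).
Proof. by rewrite /qcomm mulrDr mulrDl scalerDr => -> ->. Qed.

Lemma qcomm_sym k x y : k != 0 -> qcomm k x y -> qcomm k^-1 y x.
Proof. by rewrite /qcomm => k0 ->; rewrite scalerA mulVf // scale1r. Qed.

End QCommutation.

(** A q-deformed Heisenberg relation, the invariant shared by all pairs of adjacent diagonal
    sums. *)
Definition qheisenberg (R : realType) (q : {posnum R}) N (u v : series q N) :=
  let c := u * v - q%:num *: (v * u) in c * u = u * c /\ c * v = v * c.

(** * Adjacent diagonal sums: extension by one generator, and exchange with one *)

Section Steps.
Context {R : realType} {q : {posnum R}} {N : nat}.
Context (hq : q%:num < 1).
Notation S := (series q N).
Notation Q := (q%:num).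
Implicit Types (p r Z W u v : S).

Let Q0 : Q != 0. Proof. by rewrite gt_eqF. Qed.

(** Here p and r are adjacent diagonal sums in one column, and Z and W the generators that extend
    them to the next column. *)
Lemma qheisenberg_step p r Z W : qheisenberg p r ->
  qcomm Q Z p -> qcomm Q^-1 Z r -> qcomm 1 W p -> qcomm Q W r -> qcomm Q Z W ->
  qheisenberg ((1 + p) * Z) ((1 + r) * W).
Proof.
rewrite /qheisenberg; set c := p * r - _; move=> [cp cr] Zp Zr Wp Wr ZW.
have pr : p * r = Q *: (r * p) + c by rewrite /c addrC subrK.
have WZ : W * Z = Q^-1 *: (Z * W) by apply: qcomm_sym.
have Zc : Z * c = c * Z.
  apply/qcomm1E; rewrite /c -[1](mulfV Q0); apply: qcommDr; first exact: qcommMr.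
  rewrite -scaleNr; have : qcomm (Q / Q) Z (r * p) by rewrite mulrC; exact: qcommMr.
  by rewrite /qcomm -scalerAr -scalerAl => ->; rewrite !scalerA mulrC.
have Wc : W * c = Q *: (c * W).
  rewrite -/(qcomm Q W c) /c; apply: qcommDr.
    by rewrite -[Q]mul1r; exact: qcommMr.
  rewrite -scaleNr; have : qcomm (Q * 1) W (r * p) by exact: qcommMr.
  by rewrite mulr1 /qcomm -scalerAr -scalerAl => ->; rewrite !scalerA mulrC.
(* Moving Z and W to the right, the new q-commutator is ((1 + p) (1 + q^-1 r) - (1 + r) (1 + p)) Z W
   = T Z W. *)
set T := (Q^-1 - 1) *: r + Q^-1 *: c.
have -> : (1 + p) * Z * ((1 + r) * W) - Q *: ((1 + r) * W * ((1 + p) * Z)) = T * (Z * W).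
  have e1 : (1 + p) * Z * ((1 + r) * W) = ((1 + p) * (1 + Q^-1 *: r)) * (Z * W).
    rewrite -!mulrA; congr (_ * _); rewrite !mulrA; congr (_ * _).
    by rewrite mulrDr mulrDl mulr1 mul1r Zr -scalerAl.
  have e2 : Q *: ((1 + r) * W * ((1 + p) * Z)) = ((1 + r) * (1 + p)) * (Z * W).
    rewrite ZW -scalerAr; congr (_ *: _).
    rewrite -!mulrA; congr (_ * _); rewrite !mulrA; congr (_ * _).
    by rewrite mulrDr mulrDl mulr1 mul1r Wp scale1r.
  rewrite e1 e2 -mulrBl; congr (_ * _); rewrite !mulrDr !mulrDl !mulr1 !mul1r.
  rewrite -!scalerAr pr /T; apply: seriesP => a.
  by rewrite !(coefD, coefN, coefZ); field.
have WT : W * T = Q *: (T * W).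
  rewrite /T mulrDr mulrDl -!scalerAr -!scalerAl Wr Wc.
  by rewrite scalerDr !scalerA ![_ * Q]mulrC.
(* With T' defined by Z T = T' Z, the first commutation becomes (1 + p) T' = q^-1 T (1 + q p), which
   follows from p r = q r p + c and c p = p c. *)
split.
  have ZT : Z * T = ((Q^-1 - 1) *: (Q^-1 *: r) + Q^-1 *: c) * Z.
    by rewrite /T mulrDr mulrDl -!scalerAr -!scalerAl Zr Zc.
  have -> : (1 + p) * Z * (T * (Z * W)) =
     ((1 + p) * ((Q^-1 - 1) *: (Q^-1 *: r) + Q^-1 *: c)) * (Z * Z * W).
    by rewrite -!mulrA; congr (_ * _); rewrite !mulrA ZT.
  have -> : T * (Z * W) * ((1 + p) * Z) = Q^-1 *: (T * (1 + Q *: p)) * (Z * Z * W).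
    rewrite -scalerAl -!mulrA scalerAr; congr (_ * _).
    have WP : W * (1 + p) = (1 + p) * W.
      by rewrite mulrDr mulrDl mulr1 mul1r (qcomm1E _ _).1.
    have ZP : Z * (1 + p) = (1 + Q *: p) * Z.
      by rewrite mulrDr mulrDl mulr1 mul1r Zp scalerAl.
    rewrite [W * _]mulrA WP -mulrA WZ -!scalerAr; congr (_ *: _).
    by rewrite mulrA ZP !mulrA.
  congr (_ * _); rewrite /T !mulrDr !mulrDl !mulr1 !mul1r -!scalerAr -!scalerAl.
  rewrite pr cp; apply: seriesP => a.
  by rewrite !(coefD, coefN, coefZ); field.
(* In the second commutation the powers of q cancel, and it remains that T, a combination of r and
   c, commutes with r. *)
have Tr : T * r = r * T.
  by rewrite /T mulrDr mulrDl -!scalerAr -!scalerAl cr.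
have -> : (1 + r) * W * (T * (Z * W)) = ((1 + r) * T) * (Z * W * W).
  rewrite -!mulrA; congr (_ * _); rewrite !mulrA WT -!scalerAl -[T * W * Z]mulrA WZ.
  by rewrite -scalerAr -scalerAl scalerA mulfV // scale1r !mulrA.
have -> : (1 + r) * T = T * (1 + r).
  by rewrite [(1 + r) * T]mulrDl [T * (1 + r)]mulrDr mulr1 mul1r Tr.
have WR : W * (1 + r) = (1 + Q *: r) * W.
  by rewrite mulrDr mulrDl mulr1 mul1r Wr scalerAl.
have ZR : Z * (1 + Q *: r) = (1 + r) * Z.
  rewrite mulrDr mulrDl mulr1 mul1r -scalerAr Zr scalerA mulfV //.
  by rewrite scale1r.
by rewrite -!mulrA; congr (_ * _); rewrite [W * _]mulrA WR !mulrA ZR.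
Qed.

(* Writing [v = q w], this reduces to [w <qu> = <u> (w + c')] and
   [(u + c') <w> = <qw> u], where [c'] is the commutator of [u] and [w] divided by
   [1 - q], together with [<qx> = (1 + x) <x>]. *)
Lemma qexp_pair_shift u v Z : small u -> small v -> qheisenberg u v ->
  qcomm Q Z u -> qcomm Q^-1 Z v ->
  Z * (1 + v) * (qexp u * qexp v) = qexp u * qexp v * (1 + u) * Z.
Proof.
rewrite /qheisenberg; set c := u * v - _; move=> u0 v0 [cu cv] Zu Zv.
set w := Q^-1 *: v; have w0 : small w by exact: smallZ.
have vw : v = Q *: w by rewrite scalerA mulfV // scale1r.
have uw : u * w = Q *: (w * u) + Q^-1 *: c.
  rewrite /w -scalerAr -scalerAl /c scalerBr !scalerA mulVf // mulfV //.
  by rewrite scale1r addrC subrK.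
have c1u : (Q^-1 *: c) * u = u * (Q^-1 *: c) by rewrite -scalerAl cu -scalerAr.
have c1w : (Q^-1 *: c) * w = w * (Q^-1 *: c).
  by rewrite -scalerAl -!scalerAr cv -scalerAl.
have ZuE : qexp (Q *: u) * Z = Z * qexp u.
  by apply: qexp_intertwine => //; [exact: smallZ | rewrite -scalerAl -Zu].
have ZvE : qexp w * Z = Z * qexp v.
  by apply: qexp_intertwine => //; rewrite -scalerAl -Zv.
(* Moving Z to the right end and cancelling it leaves (1 + w) <q u> <w> = <u> <q w> (1 + u). *)
have -> : Z * (1 + v) = (1 + w) * Z by rewrite mulrDr mulrDl mulr1 mul1r Zv scalerAl.
rewrite mulrA -[(1 + w) * Z * _]mulrA -ZuE !mulrA -[_ * Z * _]mulrA -ZvE !mulrA.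
congr (_ * _); rewrite mulrDl mul1r -(heisenbergl hq u0 uw c1u) qexp_scaler //.
rewrite -mulrDr -!mulrA; congr (_ * _); rewrite vw.
have -> : 1 + u + (w + (1 - Q)^-1 *: (Q^-1 *: c)) =
   (1 + w) + (u + (1 - Q)^-1 *: (Q^-1 *: c)).
  by rewrite addrACA.
rewrite mulrDl -(qexp_scale hq w0) (heisenbergr hq w0 uw c1w).
by rewrite mulrDr mulr1.
Qed.

End Steps.

(** * Row and diagonal sums, and their intertwining relation *)

Definition bedge (i j k l : nat) : bool :=
  [|| (k == i) && (l == j.+1), (k == i.+1) && (l == j) |
      (i == k.+1) && (j == l.+1)].

(* The exponent of [q] in the relation between the generators at [(i, j)] and
   [(k, l)], extended to all pairs of naturals. *)
Definition binc (i j k l : nat) : int :=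
  (bedge i j k l : nat)%:Z - (bedge k l i j : nat)%:Z.

Lemma incidenceE N (u v : vertex N) : incidence u v = binc (vi u) (vj u) (vi v) (vj v).
Proof.
have : ~~ (edge u v && edge v u) by rewrite /edge; lia.
rewrite /incidence /binc -[bedge (vi u) _ _ _]/(edge u v).
by rewrite -[bedge (vi v) _ _ _]/(edge v u); case: (edge u v); case: (edge v u).
Qed.

Section Recursion.
Context {R : realType} {q : {posnum R}} {N : nat}.
Context (hq : q%:num < 1).
Notation S := (series q N).
Notation Q := (q%:num).

Let Q0 : Q != 0. Proof. by rewrite gt_eqF. Qed.

(* Unlike [gen], which is [1] when [(i, j)] is not a vertex, this is [0] there, so
   that the sums below need no boundary conditions. *)
Definition zgen (i j : nat) : S := if ((0 < i < j) && (j <= N))%N then gen q N i j else 0.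

Lemma zgen_eq0 i j : ~~ ((0 < i < j) && (j <= N))%N -> zgen i j = 0.
Proof. by rewrite /zgen => /negbTE ->. Qed.

Lemma zgenP i j : ((0 < i < j) && (j <= N))%N ->
  exists v : vertex N, [/\ vi v = i, vj v = j & zgen i j = vgen v].
Proof.
move=> ij; have iN : (i < N.+1)%N by lia.
have jN : (j < N.+1)%N by lia.
have ij' : (0 < i < j)%N by lia.
exists (@Vertex N (Ordinal iN, Ordinal jN) ij'); split => //.
by rewrite /zgen ij.
Qed.

Lemma zgenC i j k l : qcomm (Q ^ binc i j k l) (zgen i j) (zgen k l).
Proof.
have [/zgenP[u [ui uj ->]]|/zgen_eq0 ->] := boolP ((0 < i < j) && (j <= N))%N; last first.
  exact: qcomm0l.
have [/zgenP[v [vk vl ->]]|/zgen_eq0 ->] := boolP ((0 < k < l) && (l <= N))%N; last first.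
  exact: qcomm0r.
by rewrite /qcomm vgenC incidenceE ui uj vk vl.
Qed.

Lemma zgen_qcomm e i j k l : binc i j k l = e -> qcomm (Q ^ e) (zgen i j) (zgen k l).
Proof. by move=> <-; exact: zgenC. Qed.

Lemma small_zgen i j : small (zgen i j).
Proof.
have [/zgenP[u [_ _ ->]]|/zgen_eq0 ->//] := boolP ((0 < i < j) && (j <= N))%N.
rewrite /small vgenE /=; case: eqP => // /ffunP /(_ u).
by rewrite !ffunE eqxx.
Qed.

(* [rowsum i M] and [diagsum i M] are the sums of the monomials along the row
   segments from [(i, M)] leftwards, and along the diagonal segments that end at
   [(i, M)]. *)
Fixpoint rowsum i M : S :=
  if M is M'.+1 then zgen i M * (1 + rowsum i M') else 0.

Fixpoint diagsum i M : S :=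
  if i is i'.+1 then if M is M'.+1 then (1 + diagsum i' M') * zgen i M else 0
  else 0.

Lemma rowsumS i M : rowsum i M.+1 = zgen i M.+1 * (1 + rowsum i M).
Proof. by []. Qed.

Lemma diagsumS i M : diagsum i.+1 M.+1 = (1 + diagsum i M) * zgen i.+1 M.+1.
Proof. by []. Qed.

Lemma diagsum_eq0 i M : (M <= i)%N -> diagsum i M = 0.
Proof.
case: i M => [|i] [|M] // Mi; rewrite diagsumS zgen_eq0 ?mulr0 //.
by rewrite ltnS in Mi; apply/negP; lia.
Qed.

Lemma small_rowsum i M : small (rowsum i M).
Proof. by case: M => // M; apply/smallMl/small_zgen. Qed.

Lemma small_diagsum i M : small (diagsum i M).
Proof. by case: i M => [|i] [|M] //; apply/smallMr/small_zgen. Qed.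

(** Here t counts the steps back along the diagonal from (i, M). *)
Lemma zgen_diagsum_comm k l i M :
  (forall t, (t < i)%N -> (t < M)%N -> binc k l (i - t) (M - t) = 0) ->
  qcomm 1 (zgen k l) (diagsum i M).
Proof.
elim: i M => [|i IH] M; first by move=> _; exact: qcomm0r.
case: M => [|M] H; first exact: qcomm0r.
rewrite diagsumS -[1](mulr1 1); apply: qcommMr.
  apply: qcommDr; first exact: qcomm1r.
  by apply: IH => t ti tM; have := H t.+1; rewrite !subSS; apply.
by rewrite -(expr0z Q); apply: zgen_qcomm; have := H 0%N; rewrite !subn0; apply.
Qed.

(** Every monomial of the diagonal sum ends in Z_(i,M), so a factor q^e coming from this vertex
    alone is common to all of them. *)
Lemma zgen_diagsum_qcomm e k l i M : binc k l i M = e ->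
  (forall t, (0 < t < i)%N -> (0 < t < M)%N -> binc k l (i - t) (M - t) = 0) ->
  qcomm (Q ^ e) (zgen k l) (diagsum i M).
Proof.
case: i => [|i]; first by move=> _ _; exact: qcomm0r.
case: M => [|M] kl H; first exact: qcomm0r.
rewrite diagsumS -[Q ^ e](mul1r); apply: qcommMr; last exact: zgen_qcomm.
apply: qcommDr; first exact: qcomm1r.
apply: zgen_diagsum_comm => t ti tM.
by have := H t.+1; rewrite !subSS; apply.
Qed.

(** Induction along both diagonals at once; the edges near their ends supply the powers of q that
    [qheisenberg_step] asks for. *)
Lemma diagsum_qheisenberg i M : qheisenberg (diagsum i M) (diagsum i.+1 M).
Proof.
have H0 u : qheisenberg 0 (u : S).
  by rewrite /qheisenberg /= !(mul0r, mulr0, scaler0, subrr).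
elim: i M => [|i IH] M; first exact: H0.
case: M => [|M]; first exact: H0.
rewrite diagsumS [diagsum i.+2 _]diagsumS.
apply: (qheisenberg_step (IH M)).
- rewrite -{1}(expr1z Q); apply: zgen_diagsum_qcomm; rewrite /binc /bedge; lia.
- rewrite -(exprN1 Q); apply: zgen_diagsum_qcomm; rewrite /binc /bedge; lia.
- by apply: zgen_diagsum_comm => t *; rewrite /binc /bedge; lia.
- rewrite -{1}(expr1z Q); apply: zgen_diagsum_qcomm; rewrite /binc /bedge; lia.
- by rewrite -{1}(expr1z Q); apply: zgen_qcomm; rewrite /binc /bedge; lia.
Qed.

(** No edge joins the two diagonals: an edge changes the difference of the coordinates by at most
    one, and the diagonals differ there by at least two. *)
Lemma diagsum_comm i j M : (i.+2 <= j)%N ->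
  diagsum i M * diagsum j M = diagsum j M * diagsum i M.
Proof.
elim: i j M => [|i IH] [|j] [|M] // ij; rewrite ?mul0r ?mulr0 //.
rewrite !diagsumS; apply/qcomm1E.
have zz : qcomm 1 (zgen i.+1 M.+1) (zgen j.+1 M.+1).
  by rewrite -(expr0z Q); apply: zgen_qcomm; rewrite /binc /bedge; lia.
have dz : qcomm 1 (1 + diagsum i M) (zgen j.+1 M.+1).
  apply: qcomm1_sym; apply: qcommDr; first exact: qcomm1r.
  by apply: zgen_diagsum_comm => t *; rewrite /binc /bedge; lia.
have zd : qcomm 1 (zgen i.+1 M.+1) (1 + diagsum j M).
  apply: qcommDr; first exact: qcomm1r.
  by apply: zgen_diagsum_comm => t *; rewrite /binc /bedge; lia.
have dd : qcomm 1 (1 + diagsum i M) (1 + diagsum j M).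
  apply/qcomm1E/commrD; [exact: commr1 | apply/commr_sym/commrD].
    exact: commr1.
  by apply/commr_sym/IH.
have := qcommMl (qcommMr dd dz) (qcommMr zd zz).
by rewrite !mulr1.
Qed.

Definition diagprod M := \prod_(1 <= j < M.+1) qexp (diagsum j M).
Definition diagprods M := \prod_(1 <= m < M.+1) diagprod m.
Definition rowprod M := \prod_(1 <= i < M.+1) qexp (rowsum i M).
(** Recursive because M decreases from left to right. *)
Fixpoint rowprods M := if M is M'.+1 then rowprod M * rowprods M' else 1.

Lemma diagprodsS M : diagprods M.+1 = diagprods M * diagprod M.+1.
Proof. by rewrite /diagprods big_nat_recr. Qed.

Lemma comm_prod (f : S) m n (F : nat -> S) :
  (forall i, (m <= i < n)%N -> f * F i = F i * f) ->
  f * (\prod_(m <= i < n) F i) = (\prod_(m <= i < n) F i) * f.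
Proof.
move=> H; rewrite big_nat; apply: (big_ind (fun g => f * g = g * f)) => //.
- by rewrite mulr1 mul1r.
- by move=> g h fg fh; rewrite mulrA fg -mulrA fh mulrA.
Qed.

(** Edges change the column by at most one, so column M + 2 commutes with columns up to M. *)
Lemma zgen_diagprods i M : (0 < i)%N ->
  zgen i M.+2 * diagprods M = diagprods M * zgen i M.+2.
Proof.
move=> i0; apply: comm_prod => m /andP[_ mM]; apply: comm_prod => j _.
symmetry; apply: qexp_comm => //; first exact: small_diagsum.
by symmetry; apply/qcomm1E/zgen_diagsum_comm => t *; rewrite /binc /bedge; lia.
Qed.

(** Factors with j < i commute with Z (1 + Y_(i+1)), those with j > i + 1 commute with (1 + Y_i) Z,
    and [qexp_pair_shift] treats the two in between. *)
Lemma zgen_diagprod i M :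
  zgen i.+1 M.+1 * (1 + diagsum i.+1 M) * diagprod M =
  diagprod M * (1 + diagsum i M) * zgen i.+1 M.+1.
Proof.
have [Mi|iM] := leqP M i.
  by rewrite zgen_eq0 ?mul0r ?mulr0 ?mul0r //; apply/negP; lia.
pose P m n := \prod_(m <= j < n) qexp (diagsum j M) : S.
have zd j : j != i -> j != i.+1 -> qcomm 1 (zgen i.+1 M.+1) (diagsum j M).
  by move=> ji ji1; apply: zgen_diagsum_comm => t *; rewrite /binc /bedge; lia.
have comm_far (f : S) m n :
    (forall j, (m <= j < n)%N -> diagsum j M * f = f * diagsum j M) ->
    f * P m n = P m n * f.
  move=> H; apply: comm_prod => j jmn; symmetry; apply: qexp_comm (H j jmn).
  exact: small_diagsum.
have -> : diagprod M = P 0%N i * (qexp (diagsum i M) * qexp (diagsum i.+1 M)) * P i.+2 M.+1.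
  (* Starting at j = 0 adds the factor <0> = 1, so that i = 0 is no special case. *)
  transitivity (P 0%N M.+1); first by rewrite /P big_ltn //= qexp0 mul1r.
  rewrite /P (@big_cat_nat _ _ _ i) //=; last by lia.
  rewrite [X in _ * X]big_ltn; last by lia.
  by rewrite [X in _ * (_ * X)]big_ltn // !mulrA.
have left : zgen i.+1 M.+1 * (1 + diagsum i.+1 M) * P 0%N i =
    P 0%N i * (zgen i.+1 M.+1 * (1 + diagsum i.+1 M)).
  apply: comm_far => j /andP[_ ji]; symmetry; apply/qcomm1E; rewrite -[1]mulr1.
  apply: qcommMl; first by apply: zd; lia.
  apply/qcomm1E; rewrite mulrDl mulrDr mul1r mulr1 [in RHS]diagsum_comm //; lia.
have right : P i.+2 M.+1 * ((1 + diagsum i M) * zgen i.+1 M.+1) =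
    (1 + diagsum i M) * zgen i.+1 M.+1 * P i.+2 M.+1.
  symmetry; apply: comm_far => j /andP[ij _]; symmetry; apply/qcomm1E.
  rewrite -[1]mulr1; apply: qcommMl; last by apply: zd; lia.
  apply/qcomm1E; rewrite mulrDl mulrDr mul1r mulr1 diagsum_comm //; lia.
rewrite !mulrA left -!mulrA [X in _ = P _ _ * X]mulrA right.
congr (_ * _); rewrite !mulrA; congr (_ * _).
rewrite -[in LHS]mulrA qexp_pair_shift //; try exact: small_diagsum.
- exact: diagsum_qheisenberg.
- rewrite -{1}(expr1z Q); apply: zgen_diagsum_qcomm; rewrite /binc /bedge; lia.
- rewrite -(exprN1 Q); apply: zgen_diagsum_qcomm; rewrite /binc /bedge; lia.
Qed.

(** With U = [diagprods M] and V = [diagprod M.+1], the induction step is Z (1 + X_i) U V = Z U (1 +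
    Y_i) V = U Z (1 + Y_i) V = U V (1 + Y_(i-1)) Z. *)
Lemma rowsum_diagprods i M : (0 < i)%N ->
  rowsum i M.+1 * diagprods M = diagprods M * diagsum i M.+1.
Proof.
case: i => // i _; elim: M i => [|M IH] i.
  by rewrite rowsumS diagsumS zgen_eq0 ?mul0r ?mulr0 ?mul0r //; apply/negP; lia.
rewrite rowsumS diagprodsS diagsumS mulrA -[_ * diagprods M]mulrA.
have -> : (1 + rowsum i.+1 M.+1) * diagprods M = diagprods M * (1 + diagsum i.+1 M.+1).
  by rewrite mulrDl mulrDr mul1r mulr1 IH.
rewrite mulrA zgen_diagprods // -!mulrA; congr (_ * _).
by rewrite !mulrA zgen_diagprod.
Qed.

Lemma rowprods_diagprods M : rowprods M = diagprods M.
Proof.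
elim: M => [|M IH]; first by rewrite /diagprods big_geq.
rewrite /= IH diagprodsS /rowprod /diagprod.
rewrite !big_nat; elim: (index_iota _ _) => [|i s IHs].
  by rewrite !big_nil mul1r mulr1.
rewrite !big_cons; case: ifP => // /andP[i0 _].
rewrite -mulrA IHs mulrA (qexp_intertwine _ _ (rowsum_diagprods _ i0)) ?mulrA //.
  exact: small_rowsum.
exact: small_diagsum.
Qed.

End Recursion.

(** * Reordering products indexed by triples *)

Section Reordering.

Definition lambda_lt (l m : nat * nat * nat) : bool :=
  (l.1.1 < m.1.1)%N || (l.1.1 == m.1.1) &&
  ((l.1.2 < m.1.2)%N || (l.1.2 == m.1.2) && (l.2 < m.2)%N).

(* Lexicographic in the last point [(a + c - b - 1, c - 1)] of the diagonal
   segment, by column and then by row, and then in [a]. *)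
Definition diag_lt (l m : nat * nat * nat) : bool :=
  (l.2 < m.2)%N || (l.2 == m.2) &&
  ((l.1.1 + m.1.2 < m.1.1 + l.1.2)%N ||
   (l.1.1 + m.1.2 == m.1.1 + l.1.2)%N && (l.1.1 < m.1.1)%N).

Lemma pairwise_flatten (T : eqType) (r : rel T) (f : nat -> seq T) m n :
  (forall a, pairwise r (f a)) ->
  (forall a a' x y, (a < a' < n)%N -> x \in f a -> y \in f a' -> r x y) ->
  pairwise r (flatten [seq f a | a <- index_iota m n]).
Proof.
move=> ff fr; have := iota_ltn_sorted m (n - m).
rewrite (sorted_pairwise ltn_trans) -/(index_iota m n).
have : all (gtn n) (index_iota m n) by apply/allP => a; rewrite mem_index_iota => /andP[].
elim: (index_iota m n) => //= a s IH /andP[_ /[dup] /allP sn /IH {}IH].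
move=> /andP[/allP as_ /IH {}IH]; rewrite pairwise_cat ff IH !andbT.
apply/allrelP => x y xa /flatten_mapP[a' a's ya']; apply: fr xa ya'.
by apply/andP; split; [exact: as_ | exact: sn].
Qed.

Lemma pairwise_map_iota (T : Type) (r : rel T) (f : nat -> T) m n :
  (forall a a', (a < a')%N -> r (f a) (f a')) ->
  pairwise r [seq f a | a <- index_iota m n].
Proof.
move=> fr; rewrite pairwise_map; have := iota_ltn_sorted m (n - m).
by rewrite (sorted_pairwise ltn_trans); apply: sub_pairwise => a a'; exact: fr.
Qed.

Lemma mem_Lambda N a b c :
  ((a, b, c) \in Lambda N) = (0 < a < b)%N && (b < c < N.+2)%N.
Proof.
apply/flatten_mapP/idP => [[a' + /flatten_mapP[b' + /mapP[c' + [-> -> ->]]]]|abc].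
  by rewrite !mem_index_iota; lia.
exists a; first by rewrite mem_index_iota; lia.
apply/flatten_mapP; exists b; first by rewrite mem_index_iota; lia.
by apply/mapP; exists c; rewrite // mem_index_iota; lia.
Qed.

Lemma pairwise_Lambda N : pairwise lambda_lt (Lambda N).
Proof.
apply: pairwise_flatten => [a|a a' x y aa'].
  apply: pairwise_flatten => [b|b b' x y bb'].
    by apply: pairwise_map_iota => c c' cc'; rewrite /lambda_lt /=; lia.
  by move=> /mapP[c _ ->] /mapP[c' _ ->]; rewrite /lambda_lt /=; lia.
move=> /flatten_mapP[b _ /mapP[c _ ->]] /flatten_mapP[b' _ /mapP[c' _ ->]].
by rewrite /lambda_lt /=; lia.
Qed.

(** Triples parametrized by the last point (i, m) of the diagonal segment and its first row a, in
    the order of the factors of [diagprods]. *)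
Definition diagLambda N : seq (nat * nat * nat) :=
  flatten [seq flatten [seq [seq (a, (a + (m - i))%N, m.+1) | a <- index_iota 1 i.+1]
                           | i <- index_iota 1 m]
              | m <- index_iota 1 N.+1].

Lemma mem_diagLambda N l : (l \in diagLambda N) = (l \in Lambda N).
Proof.
case: l => [[a b] c]; rewrite mem_Lambda.
apply/flatten_mapP/idP => [[m + /flatten_mapP[i + /mapP[a' + [-> -> ->]]]]|abc].
  by rewrite !mem_index_iota; lia.
exists c.-1; first by rewrite mem_index_iota; lia.
apply/flatten_mapP; exists (c.-1 + a - b)%N; first by rewrite mem_index_iota; lia.
apply/mapP; exists a; first by rewrite mem_index_iota; lia.
by congr (_, _, _); lia.
Qed.

Lemma pairwise_diagLambda N : pairwise diag_lt (diagLambda N).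
Proof.
apply: pairwise_flatten => [m|m m' x y mm'].
  apply: pairwise_flatten => [i|i i' x y ii'].
    by apply: pairwise_map_iota => a a' aa'; rewrite /diag_lt /=; lia.
  by move=> /mapP[a _ ->] /mapP[a' _ ->]; rewrite /diag_lt /=; lia.
move=> /flatten_mapP[i _ /mapP[a _ ->]] /flatten_mapP[i' _ /mapP[a' _ ->]].
by rewrite /diag_lt /=; lia.
Qed.

Lemma perm_diagLambda N : perm_eq (Lambda N) (diagLambda N).
Proof.
apply: uniq_perm => [||l]; last by rewrite mem_diagLambda.
  apply: pairwise_uniq (pairwise_Lambda N) => l; by rewrite /lambda_lt; lia.
apply: pairwise_uniq (pairwise_diagLambda N) => l; by rewrite /diag_lt; lia.
Qed.

(** Only pairs that the two orders arrange differently have to commute: the head of s crosses just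
    the entries that precede it in t. *)
Lemma prod_reorder (A : pzRingType) (T : eqType) (r1 r2 : rel T) (F : T -> A) s t :
  perm_eq s t -> pairwise r1 s -> pairwise r2 t ->
  (forall x y, x \in s -> y \in s -> r1 x y -> r2 y x -> F x * F y = F y * F x) ->
  \prod_(x <- s) F x = \prod_(x <- t) F x.
Proof.
elim: s t => [|x s IH] t st.
  by have /perm_size/esym/size0nil -> := st.
have xt : x \in t by rewrite -(perm_mem st) mem_head.
case/splitPr: t / xt st => t1 t2 st /= /andP[/allP xs s1].
rewrite pairwise_cat /= => /and3P[t12 t1p /andP[_ t2p]] FC.
have {}st : perm_eq s (t1 ++ t2).
  by rewrite -(perm_cons x) (perm_trans st) // perm_sym -cat1s perm_catCA.
have t12' : allrel r2 t1 (x :: t2) by [].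
rewrite big_cons big_cat big_cons (IH (t1 ++ t2)) //=.
- rewrite big_cat !mulrA; congr (_ * _).
  have : forall y, y \in t1 -> F x * F y = F y * F x.
    move=> y yt; have ys : y \in s by rewrite (perm_mem st) mem_cat yt.
    apply: FC; rewrite ?mem_head ?in_cons ?ys ?orbT //; first exact: xs.
    by move/allrelP: t12'; apply; rewrite // mem_head.
  elim: (t1) => [|y u IHu] H; first by rewrite !big_nil mulr1 mul1r.
  rewrite !big_cons mulrA H ?mem_head // -!mulrA IHu // => w wu.
  by apply: H; rewrite in_cons wu orbT.
- rewrite pairwise_cat t1p t2p andbT andbT.
  by move: t12'; rewrite allrel_consr => /andP[].
- by move=> y w ys ws; apply: FC; rewrite in_cons ?ys ?ws orbT.
Qed.

End Reordering.

(* The size of the intersection of the intervals [a, a + n) and [l, h). *)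
Definition cap_size (a n l h : nat) : nat := minn (a + n) h - maxn a l.

(* The exponent of [q] in the relation between the diagonal segment with first
   point [(a, a + d)] and [n] points, and the one given by [b], [e], [m]. *)
Definition segment_inc (a d n b e m : nat) : int :=
  if e == d.+1 then
    (cap_size a n b (b + m))%:Z - (cap_size a n b.+1 (b + m).+1)%:Z
  else if e == d then
    (cap_size a n b.+1 (b + m).+1)%:Z - (cap_size a.+1 n b (b + m))%:Z
  else if d == e.+1 then
    (cap_size a.+1 n b (b + m))%:Z - (cap_size a n b (b + m))%:Z
  else 0.

Lemma segment_inc0r a d n b e : segment_inc a d n b e 0 = 0.
Proof. by rewrite /segment_inc /cap_size; do 3?case: eqP => _; lia. Qed.

Lemma segment_inc0l a d b e m : segment_inc a d 0 b e m = 0.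
Proof. by rewrite /segment_inc /cap_size; do 3?case: eqP => _; lia. Qed.

Lemma cap_size1S a l h : (l <= h)%N ->
  cap_size a 1 l h.+1 = (cap_size a 1 l h + (a == h))%N.
Proof. by rewrite /cap_size => lh; case: eqP; lia. Qed.

Lemma cap_sizeS a n l h : cap_size a n.+1 l h = (cap_size a n l h + cap_size (a + n) 1 l h)%N.
Proof. by rewrite /cap_size; lia. Qed.

(** For two fixed diagonals only coincidences of rows, up to a shift by one, contribute; summed over
    two segments they give the intersections in [segment_inc]. *)
Lemma bincE a d b e : binc a (a + d) b (b + e) =
  if e == d.+1 then (a == b)%:Z - (a == b.+1)%:Z
  else if e == d then (a == b.+1)%:Z - (a.+1 == b)%:Z
  else if d == e.+1 then (a.+1 == b)%:Z - (a == b)%:Z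
  else 0.
Proof.
rewrite /binc.
have -> : bedge a (a + d) b (b + e) =
    if e == d.+1 then a == b else if e == d then a == b.+1
    else if d == e.+1 then a.+1 == b else false.
  by rewrite /bedge; do 3?case: ifP; lia.
have -> : bedge b (b + e) a (a + d) =
    if e == d.+1 then a == b.+1 else if e == d then a.+1 == b
    else if d == e.+1 then a == b else false.
  by rewrite /bedge; do 3?case: ifP; lia.
by do 3?case: ifP.
Qed.

Lemma segment_incSr a d b e m : segment_inc a d 1 b e m.+1 =
  segment_inc a d 1 b e m + binc a (a + d) (b + m) (b + e + m).
Proof.
have bm : (b.+1 <= (b + m).+1)%N by rewrite ltnS leq_addr.
rewrite addnAC bincE /segment_inc addnS !(cap_size1S _ (leq_addr m b)) (cap_size1S _ bm).
move: (cap_size _ _ _ _) (cap_size _ _ _ _) (cap_size _ _ _ _) => x y z.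
by do 3?case: ifP => _; rewrite ?PoszD; lra.
Qed.

Lemma segment_incSl a d n b e m : segment_inc a d n.+1 b e m =
  segment_inc a d n b e m + segment_inc (a + n) d 1 b e m.
Proof.
rewrite /segment_inc !(cap_sizeS a n) !(cap_sizeS a.+1 n) addSn.
by do 3?case: ifP => _; rewrite ?PoszD; lra.
Qed.

(** On equal or neighbouring diagonals an inverted pair is nested: both intersections have the full
    length of y, and they cancel. *)
Lemma segment_inc_inversion N (x y : nat * nat * nat) :
  x \in Lambda N -> y \in Lambda N -> lambda_lt x y -> diag_lt y x ->
  segment_inc x.1.1 (x.1.2 - x.1.1) (x.2 - x.1.2)
    y.1.1 (y.1.2 - y.1.1) (y.2 - y.1.2) = 0.
Proof.
case: x y => [[a b] c] [[a' b'] c']; rewrite !mem_Lambda /lambda_lt /diag_lt /=.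
move=> abc abc' lt1 lt2; rewrite /segment_inc /cap_size.
by case: ifP => e1; [|case: ifP => e2; [|case: ifP => e3]]; lia.
Qed.

(** * Merging the factors into exponentials of sums *)

Section Segments.
Context {R : realType} {q : {posnum R}} {N : nat}.
Context (hq : q%:num < 1).
Notation S := (series q N).
Notation Q := (q%:num).
Notation Z := (@zgen R q N).
Notation mlam := (@mlambda R q N).

Let Q0 : Q != 0. Proof. by rewrite gt_eqF. Qed.

Definition segment a d n : S := \prod_(0 <= k < n) Z (a + k) (a + d + k).

Lemma segmentS a d n : segment a d n.+1 = segment a d n * Z (a + n) (a + d + n).
Proof. by rewrite /segment big_nat_recr. Qed.

Lemma segment0 a d : segment a d 0 = 1.
Proof. by rewrite /segment big_geq. Qed.

Lemma segment_qcomm a d n b e m :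
  qcomm (Q ^ segment_inc a d n b e m) (segment a d n) (segment b e m).
Proof.
have zseg i d' m' : qcomm (Q ^ segment_inc i d' 1 b e m') (Z i (i + d')) (segment b e m').
  elim: m' => [|m' IH]; first by rewrite segment_inc0r segment0; exact: qcomm1r.
  by rewrite segment_incSr segmentS expfzDr //; apply: qcommMr; last exact: zgenC.
elim: n => [|n IH]; first by rewrite segment_inc0l segment0; exact: qcomm1l.
rewrite segment_incSl segmentS expfzDr //; apply: qcommMl => //.
by have := zseg (a + n)%N d m; rewrite addnAC.
Qed.

Lemma mlambdaE a b c : (a, b, c) \in Lambda N ->
  mlam (a, b, c) = segment a (b - a) (c - b).
Proof.
rewrite mem_Lambda => abc; rewrite /mlambda /segment /= !big_nat.
apply: eq_bigr => k kc; rewrite subnKC; last by lia.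
by rewrite /zgen ifT //; lia.
Qed.

Lemma mlambda_comm (x y : nat * nat * nat) : x \in Lambda N -> y \in Lambda N ->
  lambda_lt x y -> diag_lt y x -> mlam x * mlam y = mlam y * mlam x.
Proof.
case: x y => [[a b] c] [[a' b'] c'] xL yL xy yx; rewrite !mlambdaE //.
have := segment_qcomm a (b - a) (c - b) a' (b' - a') (c' - b').
by rewrite (segment_inc_inversion xL yL xy yx) expr0z qcomm1E.
Qed.

Lemma small_mlambda l : l \in Lambda N -> small (mlam l).
Proof.
case: l => [[a b] c] lL; rewrite mlambdaE //; move: lL; rewrite mem_Lambda => abc.
have -> : (c - b = (c - b).-1.+1)%N by lia.
by rewrite segmentS; apply/smallMr/small_zgen.
Qed.

Lemma qexp_sum m n (F : nat -> S) : (forall i, (m <= i < n)%N -> small (F i)) ->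
  (forall i j, (m <= i < j)%N -> (j < n)%N -> qcomm Q (F j) (F i)) ->
  \prod_(m <= i < n) qexp (F i) = qexp (\sum_(m <= i < n) F i).
Proof.
have [mn|nm] := leqP m n; last by rewrite !big_geq ?qexp0 // ltnW.
elim: n mn => [|n IH] mn sF qF.
  by rewrite !big_geq ?qexp0.
move: mn; rewrite leq_eqVlt => /orP[/eqP <-|mn]; first by rewrite !big_geq ?qexp0.
rewrite ltnS in mn; rewrite !big_nat_recr //= IH //.
- apply: qexpD => //.
  + by rewrite big_nat; apply: small_sum => i imn; apply: sF; lia.
  + by apply: sF; lia.
  rewrite -/(qcomm Q _ _) big_nat; apply: (big_ind (fun f => qcomm Q (F n) f)).
  + exact: qcomm0r.
  + by move=> f g; exact: qcommDr.
  + by move=> i imn; apply: qF; lia.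
- by move=> i imn; apply: sF; lia.
- by move=> i j ij jn; apply: qF; lia.
Qed.

Lemma diagsumE i M : (i <= M)%N ->
  diagsum i M = \sum_(1 <= a < i.+1) segment a (M - i) (i.+1 - a).
Proof.
elim: i M => [|i IH] M iM; first by rewrite big_geq.
case: M iM => [|M] // iM; rewrite diagsumS IH // [RHS]big_nat_recr //=.
rewrite mulrDl mul1r [LHS]addrC subSS; congr (_ + _).
  rewrite mulr_suml !big_nat; apply: eq_bigr => a ai.
  have -> : (i.+2 - a = (i.+1 - a).+1)%N by lia.
  have ei : (a + (i.+1 - a) = i.+1)%N by lia.
  have eM : (a + (M - i) + (i.+1 - a) = M.+1)%N by lia.
  by rewrite segmentS ei eM.
rewrite subSnn segmentS segment0 mul1r !addn0.
by have -> : (i.+1 + (M - i) = M.+1)%N by lia.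
Qed.

(** Of two segments with the same last point, the shorter is the tail of the longer. The one
    unbalanced edge joins its first point to the preceding one and gives the factor q. *)
Lemma qexp_diagsum i M : (0 < i < M)%N -> (M <= N)%N -> \prod_(1 <= a < i.+1)
    qexp (mlam (a, (a + (M - i))%N, M.+1)) = qexp (diagsum i M).
Proof.
move=> iM MN; rewrite diagsumE; last by lia.
have lamE a : (1 <= a < i.+1)%N ->
    mlam (a, (a + (M - i))%N, M.+1) = segment a (M - i) (i.+1 - a).
  move=> ai; rewrite mlambdaE ?mem_Lambda; last by lia.
  have -> : (a + (M - i) - a = M - i)%N by lia.
  by have -> : (M.+1 - (a + (M - i)) = i.+1 - a)%N by lia.
transitivity (\prod_(1 <= a < i.+1) qexp (segment a (M - i) (i.+1 - a))).
  by rewrite !big_nat; apply: eq_bigr => a ai; rewrite lamE.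
apply: qexp_sum => [a ai|a b ab bi].
  by rewrite -lamE //; apply: small_mlambda; rewrite mem_Lambda; lia.
have := segment_qcomm b (M - i) (i.+1 - b) a (M - i) (i.+1 - a).
suff -> : segment_inc b (M - i) (i.+1 - b) a (M - i) (i.+1 - a) = 1 by rewrite expr1z.
by rewrite /segment_inc /cap_size eqxx ltn_eqF //; lia.
Qed.

Lemma prod_diagLambda :
  \prod_(l <- Lambda N) qexp (mlam l) = diagprods N.
Proof.
rewrite (prod_reorder (perm_diagLambda N) (pairwise_Lambda N) (pairwise_diagLambda N)).
  rewrite /diagLambda big_flatten big_map /diagprods !big_nat.
  apply: eq_bigr => m mN; rewrite big_flatten big_map /diagprod.
  (* The factor j = m of [diagprod m] is <0> = 1, as (m, m) is not a vertex. *)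
  rewrite [RHS]big_nat_recr /=; last by lia.
  rewrite diagsum_eq0 // qexp0 mulr1 !big_nat; apply: eq_bigr => i im.
  by rewrite big_map qexp_diagsum //; lia.
move=> x y xL yL xy yx; apply: qexp_comm2; try exact: small_mlambda.
exact: mlambda_comm.
Qed.

Lemma rho_zgen i j : (0 < i < j)%N -> (j <= N)%N -> rho (Z i j) = Z (j - i) (N.+1 - i).
Proof.
move=> ij jN; rewrite /zgen !ifT; [exact: rho_gen | lia | lia].
Qed.

(** Diagonals become rows: the constant difference b - a is the new row, and each step down the
    diagonal moves one column to the left. *)
Lemma rho_mlambda a b c : (a, b, c) \in Lambda N ->
  rho (mlam (a, b, c)) = \prod_(0 <= k < c - b) Z (b - a) (N.+1 - a - k).
Proof.
move=> abcL; rewrite mlambdaE // rmorph_prod; move: abcL; rewrite mem_Lambda => abc.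
rewrite !big_nat; apply: eq_bigr => k kc.
transitivity (Z (a + (b - a) + k - (a + k)) (N.+1 - (a + k))).
  by apply: rho_zgen; lia.
have -> : (a + (b - a) + k - (a + k) = b - a)%N by lia.
by have -> : (N.+1 - (a + k) = N.+1 - a - k)%N by lia.
Qed.

Lemma rowsumE i M : (i <= M)%N ->
  rowsum i M = \sum_(0 <= n < M - i) \prod_(0 <= k < n.+1) Z i (M - k).
Proof.
elim: M => [|M IH] iM; first by rewrite big_geq //; lia.
have [Mi|{}iM] := ltnP M i.
  rewrite rowsumS zgen_eq0 ?mul0r; last by apply/negP; lia.
  by rewrite big_geq //; lia.
rewrite rowsumS IH // subSn // [RHS]big_nat_recl // big_nat1 subn0.
rewrite mulrDr mulr1; congr (_ + _); rewrite mulr_sumr; apply: eq_bigr => n _.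
by rewrite [RHS]big_nat_recl.
Qed.

Lemma qexp_rowsum a b : (0 < a < b)%N -> (b < N.+2)%N ->
  \prod_(b.+1 <= c < N.+2) qexp (rho (mlam (a, b, c))) =
  qexp (rowsum (b - a) (N.+1 - a)).
Proof.
move=> ab bN; rewrite rowsumE; last by lia.
rewrite qexp_sum => [|c bc|c d cd dN].
- congr qexp; rewrite -{1}(add0n b.+1) big_addn.
  have -> : (N.+2 - b.+1 = N.+1 - a - (b - a))%N by lia.
  rewrite !big_nat; apply: eq_bigr => n nN.
  rewrite rho_mlambda ?mem_Lambda; last by lia.
  by have -> : (n + b.+1 - b = n.+1)%N by lia.
- rewrite rho_mlambda ?mem_Lambda; last by lia.
  have -> : (c - b = (c - b).-1.+1)%N by lia.
  by rewrite big_nat_recr //=; apply/smallMr/small_zgen.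
(* The relation is the one between diagonal segments with a common first point, transported by
   [rho]. *)
rewrite !mlambdaE ?mem_Lambda; try lia.
have := segment_qcomm a (b - a) (d - b) a (b - a) (c - b).
have -> : segment_inc a (b - a) (d - b) a (b - a) (c - b) = 1.
  by rewrite /segment_inc /cap_size eqxx ltn_eqF //; lia.
by rewrite expr1z => /(congr1 rho); rewrite linearZ /= !rmorphM.
Qed.

(** The lexicographic order already groups the factors: a gives the column M = N + 1 - a, hence M
    decreasing, and b gives the row b - a. *)
Lemma prod_rho_Lambda :
  \prod_(l <- Lambda N) qexp (rho (mlam l)) = rowprods N.
Proof.
have rowprodE a : (0 < a < N.+2)%N ->
    \prod_(a.+1 <= b < N.+2) \prod_(b.+1 <= c < N.+2) qexp (rho (mlam (a, b, c)))
    = rowprod (N.+1 - a).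
  move=> aN; rewrite /rowprod.
  transitivity (\prod_(a.+1 <= b < N.+2) qexp (rowsum (b - a) (N.+1 - a) : S)).
    by rewrite !big_nat; apply: eq_bigr => b ab; apply: qexp_rowsum; lia.
  rewrite -addn1 addnC big_addn.
  have -> : (N.+2 - a = (N.+1 - a).+1)%N by lia.
  by apply: eq_bigr => i _; rewrite addnK.
transitivity (\prod_(1 <= a < N.+2) rowprod (N.+1 - a) : S).
  rewrite /Lambda big_flatten big_map !big_nat; apply: eq_bigr => a aN.
  rewrite -rowprodE // big_flatten big_map; apply: eq_bigr => b _.
  by rewrite big_map.
have rowprodsE M : (M <= N)%N -> \prod_(N.+1 - M <= a < N.+2) rowprod (N.+1 - a) =
    rowprods M :> S.
  elim: M => [|M IH] MN.
    by rewrite subn0 big_nat1 subnn /rowprod big_geq.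
  rewrite big_ltn; last by lia.
  have -> : ((N.+1 - M.+1).+1 = N.+1 - M)%N by lia.
  rewrite IH /=; last by lia.
  by have -> : (N.+1 - (N.+1 - M.+1) = M.+1)%N by lia.
by rewrite -rowprodsE // subSnn.
Qed.

Lemma prod_qexp_rho : \prod_(l <- Lambda N) qexp (mlam l) =
  \prod_(l <- Lambda N) qexp (rho (mlam l)).
Proof. by rewrite prod_diagLambda prod_rho_Lambda rowprods_diagprods. Qed.

End Segments.

(** * Compatibility with [rho], and removal of generators *)

Section Reduction.
Context {R : realType} {q : {posnum R}} {N : nat}.
Notation S := (series q N).
Implicit Types (f g x : S) (a b c : expo N).

(** The scalar accounts for the powers of q produced by reordering generators. *)
Definition monomial x := exists k a, x = k *: mon a.

Lemma monomial1 : monomial 1.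
Proof. by exists 1, 0; rewrite scale1r. Qed.

Lemma monomialM x y : monomial x -> monomial y -> monomial (x * y).
Proof.
move=> [k [a ->]] [l [b ->]]; rewrite -scalerAl -scalerAr monM !scalerA.
by do 2 eexists.
Qed.

Lemma monomialX n x : monomial x -> monomial (x ^+ n).
Proof.
move=> mx; elim: n => [|n IH]; first exact: monomial1.
by rewrite exprS; exact: monomialM.
Qed.

Lemma monomial_prod I (r : seq I) (P : pred I) (F : I -> S) :
  (forall i, P i -> monomial (F i)) -> monomial (\prod_(i <- r | P i) F i).
Proof. by move=> F0; apply: big_ind => //; [exact: monomial1 | exact: monomialM]. Qed.

Lemma monomial_gen i j : monomial (gen q N i j).
Proof. by exists 1; eexists; rewrite scale1r. Qed.

Lemma monomial_rho x : monomial x -> monomial (rho x).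
Proof.
move=> [k [a ->]]; rewrite linearZ /= rho_mon.
have [l [b ->]] : monomial (omon (@rgen R q N) a).
  by apply: monomial_prod => v _; apply/monomialX/monomial_gen.
by rewrite scalerA; do 2 eexists.
Qed.

Lemma eqdeg_rho n f g : eqdeg n f g -> eqdeg n (rho f) (rho g).
Proof.
move=> fg c cn; rewrite !(coef_rho _ (leqnn _)); apply: eq_bigr => a _.
have [->|/homog_omon_rgen ac] := eqVneq (coef (omon (@rgen R q N) a) c) 0.
  by rewrite !mulr0.
by rewrite fg // -ac.
Qed.

Lemma small_rho x : small x -> small (rho x).
Proof. by move=> /smallE /eqdeg_rho; rewrite linear0 => /smallE. Qed.

(** Since [rho] preserves degrees, it may be applied to truncations of the series. *)
Lemma rho_qexp x : small x -> rho (qexp x) = qexp (rho x).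
Proof.
move=> x0; apply: eqdegP => n.
apply: eqdeg_trans (eqdeg_rho (qexpE x0 (leqnn n))) _.
apply: eqdeg_sym; apply: eqdeg_trans (qexpE (small_rho x0) (leqnn n)) _.
rewrite linear_sum => c _; congr coef; apply: eq_bigr => k _ /=.
by rewrite !qtermE linearZ rmorphXn rmorphN.
Qed.

Context (I : {set vertex N}).

Definition meets a : bool := [exists v in I, (0 < a v)%N].

Lemma meetsD a b : meets (a + b) = meets a || meets b.
Proof.
apply/existsP/orP => [[v /andP[vI]]|[] /existsP[v /andP[vI v0]]].
- rewrite expoD addn_gt0 => /orP[v0|v0]; [left | right];
    by apply/existsP; exists v; rewrite vI.
- by exists v; rewrite vI expoD addn_gt0 v0.
- by exists v; rewrite vI expoD addn_gt0 v0 orbT.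
Qed.

Lemma meets0 : meets 0 = false.
Proof. by apply/existsP => -[v]; rewrite ffunE andbF. Qed.

(* The quotient by the ideal generated by the [Z_v] with [v] in [I], realized on
   the series in the other generators. *)
Definition kill f : S := Series q N (fun a => if meets a then 0 else coef f a).

Lemma kill1 : kill 1 = 1.
Proof.
apply: seriesP => a /=; case: ifP => // am; case: eqP => // a0.
by rewrite a0 meets0 in am.
Qed.

Lemma killM f g : kill (f * g) = kill f * kill g.
Proof.
apply: seriesP => c; rewrite [LHS]/=; have [cm|cm] := ifPn; last first.
  apply: coefM_eq => a b abc /=; move: cm; rewrite -abc meetsD negb_or.
  by move=> /andP[/negbTE -> /negbTE ->].
rewrite -[LHS](coef0 (q := q) c) -(mul0r (0 : S)); apply: coefM_eq => a b abc /=.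
move: cm; rewrite -abc meetsD => /orP[->|->]; first by rewrite !mul0r.
by rewrite !mulr0.
Qed.

Lemma killN f : kill (- f) = - kill f.
Proof. by apply: seriesP => a /=; case: ifP; rewrite ?oppr0. Qed.

Lemma killX n f : kill (f ^+ n) = kill f ^+ n.
Proof.
by elim: n => [|n IH]; [exact: kill1 | rewrite !exprS killM IH].
Qed.

Lemma kill_prod J (r : seq J) (F : J -> S) :
  kill (\prod_(i <- r) F i) = \prod_(i <- r) kill (F i).
Proof. exact: (big_morph _ killM kill1). Qed.

(** At a given exponent, [kill] either keeps the coefficients of all powers of - x or annihilates
    them all. *)
Lemma kill_qexp x : kill (qexp x) = qexp (kill x).
Proof.
have E n c : coef ((- kill x) ^+ n) c = if meets c then 0 else coef ((- x) ^+ n) c.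
  by rewrite -killN -killX.
apply: seriesP => c; rewrite [LHS]/=; symmetry.
transitivity (\sum_(n \in [set: nat]) (if meets c then 0 else coef ((- x) ^+ n) c)
    / \prod_(1 <= k < n.+1) (1 - q%:num ^+ k)).
  by apply: eq_fsbigr => n _; rewrite E.
by case: ifP => // _; rewrite fsbig1 // => n _; rewrite mul0r.
Qed.

Lemma kill_monomial x : monomial x ->
  kill x = if [exists v in I, occurs v x] then 0 else x.
Proof.
move=> xm; apply: seriesP => c; rewrite [LHS]/=.
have [|no] := boolP [exists v in I, occurs v x].
  move=> /existsP[v /andP[vI /asboolP[b + bv]]]; case: xm => k [a ->] /=.
  have [ba|_] := eqVneq b a; last by rewrite mulr0 eqxx.
  move=> _; case: ifP => // cm; have [ca|_] := eqVneq c a; last by rewrite mulr0.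
  by case/negP: (negbT cm); apply/existsP; exists v; rewrite vI ca -ba.
case: ifP => // /existsP[v /andP[vI cv]]; apply/esym/eqP.
apply: contraNT no => xc; apply/existsP; exists v; rewrite vI.
by apply/asboolP; exists c.
Qed.

(** A factor whose argument contains a killed generator becomes <0> = 1, which is the prescribed
    replacement. *)
Lemma Tred_kill s :
  Tred q I s = kill (\prod_(l <- Lambda N) qexp (iter s rho (mlambda q N l))).
Proof.
rewrite kill_prod; apply: eq_bigr => l _; rewrite kill_qexp kill_monomial.
  by case: ifP => // _; rewrite qexp0.
elim: s => [|s IH] /=; last exact: monomial_rho.
by apply: monomial_prod => k _; exact: monomial_gen.
Qed.

End Reduction.

Theorem proposition1 (R : realType) (q : {posnum R}) (hq : q%:num < 1)
    (N : nat) (hN : (2 <= N)%N) (I : {set vertex N}) :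
  Tred q I 0 = Tred q I 1 /\ Tred q I 1 = Tred q I 2.
Proof.
have TT := prod_qexp_rho (N := N) hq; rewrite !Tred_kill /= TT; split => //.
(* Applying [rho] to T = rho(T) gives rho(T) = rho(rho(T)). *)
congr kill; rewrite -TT.
have smL l : l \in Lambda N -> small (mlambda q N l) by exact: small_mlambda.
transitivity (rho (\prod_(l <- Lambda N) qexp (mlambda q N l))).
  rewrite {1}TT rmorph_prod !big_seq; apply: eq_bigr => l lL.
  by rewrite -rho_qexp //; exact: smL.
rewrite {1}TT rmorph_prod !big_seq; apply: eq_bigr => l lL.
by apply: rho_qexp; apply/small_rho/smL.
Qed.
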